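(* The function $\mathbf D$ defined for $\xi_1,\xi_2\in\widetilde{\mathcal X}$ by $$\mathbf D(\xi_1,\xi_2)=\sum_{r=1}^\infty\frac{1}{2^r}\frac{1}{1+\|f_r\|_\infty}\bigg|\sum_{\widetilde\alpha\in\xi_1}\int f_r(x_1,\ldots,x_{k_r})\prod_{i=1}^{k_r}\alpha(\mathrm dx_i)-\sum_{\widetilde\alpha\in\xi_2}\int f_r(x_1,\ldots,x_{k_r})\prod_{i=1}^{k_r}\alpha(\mathrm dx_i)\bigg|$$ is a metric on $\widetilde{\mathcal X}$.
   Context: Let $\mathcal M_{\le 1}=\mathcal M_{\le 1}(\mathbb R^d)$ be the space of all sub-probability measures on $\mathbb R^d$ (non-negative measures with total mass less than or equal to one). For $\alpha\in\mathcal M_{\le 1}$ its orbit is $\widetilde\alpha=\{\alpha\star\delta_x: x\in\mathbb R^d\}$, the set of all translates of $\alpha$ (here $\star$ is convolution and $\delta_x$ the unit point mass at $x$). The space $\widetilde{\mathcal X}$ is $$\widetilde{\mathcal X}=\bigg\{\xi:\ \xi=\{\widetilde\alpha_i\}_{i\in I},\ \alpha_i\in\mathcal M_{\le 1},\ \sum_{i\in I}\alpha_i(\mathbb R^d)\le 1\bigg\},$$ where the collections are empty, finite or countable. An orbit may be repeated more than once in an element $\xi$; the number of its occurrences is its multiplicity, and sums $\sum_{\widetilde\alpha\in\xi}$ are taken with multiplicity. Sums over the empty collection are $0$. For $k\ge 2$, $\mathcal F_k$ is the space of continuous functions $f:(\mathbb R^d)^k\to\mathbb R$ that are translation invariant,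 $f(x_1+y,\dots,x_k+y)=f(x_1,\dots,x_k)$ for all $y,x_1,\dots,x_k\in\mathbb R^d$, and vanish at infinity in the sense that $\lim_{\max_{i\ne j}|x_i-x_j|\to\infty}f(x_1,\dots,x_k)=0$. Each $\mathcal F_k$ is separable under the uniform metric. Let $\mathcal F=\bigcup_{k\ge2}\mathcal F_k$, and let $\{f_r(x_1,\dots,x_{k_r})\}_{r\in\mathbb N}$, with $f_r\in\mathcal F_{k_r}$, be a countable sequence dense in $\mathcal F$, obtained by choosing a countable dense subset of each $\mathcal F_k$ and ordering all of them as a single sequence. For $f\in\mathcal F_k$ the integral $\int f(x_1,\dots,x_k)\prod_{i=1}^k\alpha(\mathrm dx_i)$ depends only on the orbit $\widetilde\alpha$, since $f$ is translation invariant.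
   Formalization: Occurrences of the orbit of the zero measure are disregarded when deciding equality of elements of the space: literally, the collection consisting of the zero measure's orbit and the empty collection are distinct but at distance 0, so D would not be a metric. *)

(* Defs.v *)
From HB Require Import structures.
From mathcomp Require Import all_boot all_order all_algebra generic_quotient.
From mathcomp Require Import all_classical all_reals all_analysis.
From mathcomp Require Import giry.

Set Implicit Arguments.
Unset Strict Implicit.
Unset Printing Implicit Defensive.

Import Order.TTheory GRing.Theory Num.Theory.
Import numFieldNormedType.Exports.

Local Open Scope classical_set_scope.
Local Open Scope card_scope.
Local Open Scope ring_scope.

(* The space 'rV[R]_d equipped with its Borel sigma-algebra. *)
Definition Rd (R : realType) (d : nat) :=
  g_sigma_algebraType (@open 'rV[R]_d).

Definition subprob (R : realType) (d : nat) := subprobability (Rd R d) R.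

Section orbits.
Context {R : realType} {d : nat}.
Implicit Types alpha beta : subprob R d.

(* The convolution of alpha and dirac_x: the image of the product measure under
   addition. It is only meaningful on Borel sets. *)
Definition translate alpha (x : 'rV[R]_d) : set (Rd R d) -> \bar R :=
  pushforward (alpha \x dirac (x : Rd R d))%E
    (fun p => ((p.1 : 'rV[R]_d) + (p.2 : 'rV[R]_d)) : Rd R d).

(* A library measure also carries (irrelevant) values on non-measurable sets,
   so the translates of alpha are identified up to agreement on Borel sets. *)
Definition measure_orbit alpha : set (subprob R d) :=
  [set beta | exists x : 'rV[R]_d,
     forall A, measurable A -> beta A = translate alpha x A].

End orbits.

(* The collection of the orbits of member i, for i in idx; as idx is an
   arbitrary set of natural numbers, it is empty, finite or countable. *)
Record collection (R : realType) (d : nat) := Collection {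
  idx : set nat ;
  member : nat -> subprob R d ;
  total_mass_le1 : (\esum_(i in idx) member i [set: Rd R d] <= 1)%E
}.

HB.instance Definition _ R d := gen_eqMixin (collection R d).
HB.instance Definition _ R d := gen_choiceMixin (collection R d).

Section Xtilde.
Context {R : realType} {d : nat}.
Implicit Types xi : collection R d.

(* The positions at which the orbit o occurs in xi; its cardinality is the
   multiplicity of o. *)
Definition occurrences xi (o : set (subprob R d)) : set nat :=
  [set i | idx xi i /\ measure_orbit (member xi i) = o].

(* Two collections are the same element when every orbit has the same
   multiplicity in both. Occurrences of the zero measure are disregarded:
   they contribute nothing to any integral, so that the distance could not
   tell them apart from the empty collection. *)
Definition same_orbits xi1 xi2 : bool :=
  `[< forall alpha : subprob R d, alpha [set: Rd R d] != 0%E ->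
        occurrences xi1 (measure_orbit alpha) #=
        occurrences xi2 (measure_orbit alpha) >].

Lemma same_orbits_refl : reflexive same_orbits.
Proof. by move=> xi; apply/asboolP => alpha _; exact: card_eqxx. Qed.

Lemma same_orbits_sym : symmetric same_orbits.
Proof.
by move=> xi1 xi2; apply/asboolP/asboolP => h alpha a0; rewrite card_eq_sym h.
Qed.

Lemma same_orbits_trans : transitive same_orbits.
Proof.
move=> xi2 xi1 xi3 /asboolP h12 /asboolP h23; apply/asboolP => alpha a0.
exact: card_eq_trans (h12 _ a0) (h23 _ a0).
Qed.

End Xtilde.

Canonical same_orbits_equiv (R : realType) (d : nat) :=
  EquivRel (@same_orbits R d)
    same_orbits_refl same_orbits_sym same_orbits_trans.

Definition Xtilde (R : realType) (d : nat) : Type :=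
  {eq_quot @same_orbits R d}%qT.

HB.instance Definition _ R d := Choice.on (Xtilde R d).
HB.instance Definition _ R d := EqQuotient.on (Xtilde R d).

Section test_functions.
Context {R : realType} {d : nat}.

(* A point (x_1, ..., x_k) of (R^d)^k is the k x d matrix with rows x_i. *)

(* `| _ | is the maximum norm of R^d; all norms give the same notion of
   vanishing at infinity below. *)
Definition spread k (X : 'M[R]_(k, d)) : R :=
  \big[Num.max/0]_(p : 'I_k * 'I_k | p.1 != p.2) `|row p.1 X - row p.2 X|.

Definition translation_invariant k (f : 'M[R]_(k, d) -> R) : Prop :=
  forall (y : 'rV[R]_d) (X : 'M[R]_(k, d)), f (X + \matrix_(i < k) y) = f X.

Definition vanishes_at_infinity k (f : 'M[R]_(k, d) -> R) : Prop :=
  forall e : R, 0 < e ->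
    exists M : R, forall X : 'M[R]_(k, d), M < spread X -> `|f X| < e.

Definition calF k : set ('M[R]_(k, d) -> R) :=
  [set f | [/\ continuous f, translation_invariant f & vanishes_at_infinity f]].

Definition sup_norm k (f : 'M[R]_(k, d) -> R) : R :=
  sup [set `|f X| | X in [set: 'M[R]_(k, d)]].

(* A function of some number k = projT1 f of variables in R^d. *)
Definition test_function := {k : nat & 'M[R]_(k, d) -> R}.

Definition dense_in_calF (f : nat -> test_function) : Prop :=
  (forall r, (2 <= projT1 (f r))%N /\ calF (projT2 (f r))) /\
  (forall k (g : 'M[R]_(k, d) -> R) (e : R),
     (2 <= k)%N -> calF g -> 0 < e ->
     exists r h, f r = existT _ k h /\ forall X, `|h X - g X| < e).

End test_functions.

Section product_measure.
Context {R : realType} {d : measure_display} {T : measurableType d}.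

Lemma measurable_cons_pair n :
  measurable_fun [set: T * n.-tuple T]
    (fun p => [the n.+1.-tuple T of p.1 :: p.2]).
Proof.
by apply: (@measurable_cons _ _ (T * n.-tuple T)%type T fst n snd).
Qed.

(* The k-fold product measure alpha x ... x alpha on T^k. *)
Fixpoint power_measure (alpha : subprobability T R) (k : nat) :
    subprobability (k.-tuple T) R :=
  match k with
  | 0%N => giry_ret [tuple]
  | n.+1 => giry_map (@measurable_cons_pair n)
              (giry_prod (alpha, power_measure alpha n))
  end.

End product_measure.

Section metric.
Context {R : realType} {d : nat}.

Definition integral_power (f : @test_function R d) (alpha : subprob R d) : R :=
  \int[power_measure alpha (projT1 f)]_x
    projT2 f (\matrix_(i < projT1 f) (tnth x i : 'rV[R]_d)).

Definition sum_integrals (f : @test_function R d) (xi : collection R d) : R :=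
  limn (fun n =>
    \sum_(0 <= i < n | i \in idx xi) integral_power f (member xi i)).

(* As r starts from 0 here, the weights are 2^-(r+1). *)
Definition D_collection (f : nat -> @test_function R d)
    (xi1 xi2 : collection R d) : R :=
  limn (series (fun r =>
    (2 ^+ r.+1)^-1 * (1 + sup_norm (projT2 (f r)))^-1 *
    `|sum_integrals (f r) xi1 - sum_integrals (f r) xi2|)).

(* Defined on classes through representatives. *)
Definition D (f : nat -> @test_function R d) (xi1 xi2 : Xtilde R d) : R :=
  D_collection f (repr xi1) (repr xi2).

End metric.

Definition is_metric (R : realType) (T : Type) (dist : T -> T -> R) : Prop :=
  [/\ forall x y, 0 <= dist x y,
      forall x y, dist x y = 0 <-> x = y,
      forall x y, dist x y = dist y x &
      forall x y z, dist x z <= dist x y + dist y z].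

(* Main.v *)
Require Import Defs.
From HB Require Import structures.
From mathcomp Require Import all_boot all_order all_algebra generic_quotient.
From mathcomp Require Import all_classical all_reals all_analysis.
From mathcomp Require Import measurable_realfun giry ring lra.
Import Order.TTheory GRing.Theory Num.Theory.
Import numFieldNormedType.Exports.
Local Open Scope classical_set_scope.
Local Open Scope ring_scope.

Set Implicit Arguments.
Unset Strict Implicit.
Unset Printing Implicit Defensive.

(* For a test function [phi] on [R^d] with bounded support put
   [corr phi (alpha, x) = \int phi (y - x) alpha(dy)]; it only depends on the
   translate of [alpha] by [-x].  The function
   [(x_0, ..., x_n) |-> \prod_j phi_j (x_j - x_0)] belongs to [calF], and its
   integral against a power of [alpha] is
   [\int \prod_j corr phi_j (alpha, x) alpha(dx)].  Hence, when the distance of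
   two collections vanishes, the functionals
   [h |-> \sum_i \int h (alpha_i, x) alpha_i(dx)] of the two collections agree on
   products of functions [corr phi], and then on the closure of these products
   under linear combinations and bounded pointwise limits.  This closure contains
   the indicator of [{(beta, x) | beta in the orbit of alpha}]: by compactness
   that set is obtained by countable operations from inequalities between
   finitely many [corr phi_l].  On this indicator, the functional is the
   mass of [alpha] times the multiplicity of its orbit. *)

(** * Rational balls and Borel measurability *)

Section mx_norm_entries.
Context {R : realType} {m n : nat}.
Implicit Types X : 'M[R]_(m, n).

Lemma ler_mx_entry X i j : `|X i j| <= `|X|.
Proof.
rewrite [leRHS]/Num.norm /= mx_normrE; apply/bigmax_geP; right => /=.
by exists (i, j).
Qed.

Lemma mx_norm_leP X (e : R) : 0 <= e ->
  (forall i j, `|X i j| <= e) -> `|X| <= e.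
Proof.
move=> e0 H; rewrite [leLHS]/Num.norm /= mx_normrE.
by apply/bigmax_leP; split => // -[i j] _; exact: H.
Qed.

Lemma mx_norm_ltP X (e : R) : 0 < e ->
  (forall i j, `|X i j| < e) -> `|X| < e.
Proof.
move=> e0 H; rewrite [ltLHS]/Num.norm /= mx_normrE.
by apply/bigmax_ltP; split => // -[i j] _; exact: H.
Qed.

End mx_norm_entries.

Section rational_balls.
Context {R : realType} {m n : nat}.
Implicit Types (X Y : 'M[R]_(m, n)) (U : set 'M[R]_(m, n)).

Lemma ler_norm_row X i : `|row i X| <= `|X|.
Proof. by apply: mx_norm_leP => // a j; rewrite mxE ler_mx_entry. Qed.

Definition rational_ball (p : 'M[rat]_(m, n) * nat) : set 'M[R]_(m, n) :=
  [set X | `|X - map_mx ratr p.1| < p.2.+1%:R^-1].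

Lemma rational_approx X (e : R) : 0 < e ->
  exists q : 'M[rat]_(m, n), `|X - map_mx ratr q| < e.
Proof.
move=> e0.
have H i j : exists q : rat, `|X i j - ratr q| < e.
  have /rat_in_itvoo[q /itvP qe] : X i j - e < X i j + e by lra.
  by exists q; rewrite ltr_distlC; rewrite !qe.
exists (\matrix_(i, j) sval (cid (H i j))).
apply: mx_norm_ltP => // i j; rewrite !mxE.
by case: cid.
Qed.

(** The rational balls, indexed by a countable type, form a base of the topology. This writes open
    sets as countable unions. *)
Lemma open_rational_ball U X : open U -> U X ->
  exists2 p, rational_ball p `<=` U & rational_ball p X.
Proof.
move=> oU UX.
have /nbhs_ballP[e /= e0 eU] : nbhs X U by exact: open_nbhs_nbhs.
have [k ke] : exists k : nat, k.+1%:R^-1 < e / 2.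
  have e2 : 0 < e / 2 by lra.
  by have [k _ kP] := near_infty_natSinv_lt (PosNum e2); exists k; exact: (kP k (leqnn k)).
have k0 : 0 < k.+1%:R^-1 :> R by rewrite invr_gt0.
have [q qX] := rational_approx X k0.
exists (q, k) => //= Y; rewrite /rational_ball /= => qY.
apply: eU; rewrite -ball_normE /=.
rewrite distrC in qY.
apply: le_lt_trans (ler_distD (map_mx ratr q) X Y) _.
by rewrite [e]splitr ltrD// (lt_trans _ ke).
Qed.

End rational_balls.

Section Borel.
Context {R : realType} {d : nat}.

Lemma open_measurable_Rd (U : set 'rV[R]_d) :
  open U -> measurable (U : set (Rd R d)).
Proof. by move=> oU; apply: sub_sigma_algebra. Qed.

(** For the maximum norm a ball of matrices is the product of the balls of its rows, hence a finite
    intersection of preimages under the coordinates. *)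
Lemma measurable_tuple_rational_ball k (p : 'M[rat]_(k, d) * nat) :
  measurable [set x : k.-tuple (Rd R d) |
    rational_ball p (\matrix_(i < k) (tnth x i : 'rV[R]_d))].
Proof.
rewrite (_ : mkset _ = \bigcap_(i in [set: 'I_k]) (fun x : k.-tuple (Rd R d) => tnth x i) @^-1`
   (rational_ball (row i p.1, p.2) : set (Rd R d))).
  apply: fin_bigcap_measurable => // i _.
  rewrite -[X in measurable X]setTI; apply: measurable_tnth => //.
  apply: open_measurable_Rd.
  rewrite (_ : rational_ball _ = ball (map_mx ratr (row i p.1) : 'rV[R]_d) p.2.+1%:R^-1).
    exact: ball_open.
  by apply/seteqP; split=> X; rewrite -ball_normE /rational_ball /= distrC.
have p0 : 0 < p.2.+1%:R^-1 :> R by rewrite invr_gt0.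
apply/seteqP; split => [x /= H i _ /=|x /= H].
  apply: le_lt_trans H.
  by apply: mx_norm_leP => // a j; apply: le_trans (ler_mx_entry _ i j); rewrite !mxE (ord1 a).
apply: mx_norm_ltP => // i j.
have := H i I; rewrite /rational_ball /=; apply: le_lt_trans.
by apply: le_trans (ler_mx_entry _ ord0 j); rewrite !mxE.
Qed.

(** Tuples carry the product sigma-algebra rather than the Borel one of matrices, so an open
    preimage is first decomposed into countably many rational balls. *)
Lemma continuous_measurable_tuple k (g : 'M[R]_(k, d) -> R) : continuous g ->
  measurable_fun [set: k.-tuple (Rd R d)]
    (fun x => g (\matrix_(i < k) (tnth x i : 'rV[R]_d))).
Proof.
move=> cg; apply: (measurability _ (RGenOpens.measurableE R)) => /=.
move=> _ [_ [a [b ->] <-]]; rewrite setTI.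
pose U := g @^-1` `]a, b[.
have oU : open U.
  by apply: open_comp; [move=> ? _; exact: cg|exact: interval_open].
rewrite (_ : _ @^-1` _ = \bigcup_(p in [set p | rational_ball p `<=` U])
   [set x : k.-tuple (Rd R d) | rational_ball p (\matrix_(i < k) (tnth x i : 'rV[R]_d))]).
  rewrite bigcup_mkcond; apply: countable_bigcupT_measurable => // p.
  by case: ifP => // _; exact: measurable_tuple_rational_ball.
apply/seteqP; split => [x /= Ux|x /= [p pU px]]; last exact: pU.
by have [p pU px] := open_rational_ball oU Ux; exists p.
Qed.

Lemma continuous_measurable_Rd (g : 'rV[R]_d -> R) : continuous g ->
  measurable_fun [set: Rd R d] g.
Proof.
move=> cg; apply: (measurability _ (RGenOpens.measurableE R)) => /=.
move=> _ [_ [a [b ->] <-]]; rewrite setTI; apply: open_measurable_Rd.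
by apply: open_comp; [move=> ? _; exact: cg|exact: interval_open].
Qed.

Lemma measurable_translation (v : 'rV[R]_d) :
  measurable_fun [set: Rd R d] (fun x : Rd R d => ((x : 'rV[R]_d) + v) : Rd R d).
Proof.
apply: (@measurability _ _ (Rd R d) (Rd R d) _ _ (@open 'rV[R]_d)) => //.
move=> _ [U oU <-]; rewrite setTI; apply: open_measurable_Rd.
have cT : continuous (fun x : 'rV[R]_d => x + v).
  by move=> x; exact: (cvgD (@cvg_id _ _) (cvg_cst v)).
by apply: (@open_comp _ _ (fun x : 'rV[R]_d => x + v)) => // x _; exact: cT.
Qed.

End Borel.

(** * Test functions *)

Lemma lipschitz_continuous (R : realType) (V W : normedModType R) (f : V -> W)
    (L : R) : (forall x y, `|f x - f y| <= L * `|x - y|) -> continuous f.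
Proof.
move=> fL x; apply/cvgrPdist_lt => e e0; near=> y.
have L0 : 0 < `|L| + 1 by rewrite ltr_pwDr.
apply: le_lt_trans (fL x y) _.
apply: (@le_lt_trans _ _ ((`|L| + 1) * `|x - y|)).
  by rewrite ler_wpM2r// (le_trans (ler_norm L))// lerDl.
rewrite mulrC -ltr_pdivlMr//; near: y.
by apply: cvgr_dist_lt => //; exact: divr_gt0.
Unshelve. all: by end_near. Qed.

Section test_functions.
Context {R : realType} {d : nat}.

Lemma ler_spread k (X : 'M[R]_(k, d)) i j : i != j ->
  `|row i X - row j X| <= spread X.
Proof.
move=> ij; rewrite /spread.
exact: (@le_bigmax_cond _ _ _ _ (i, j) (fun p => p.1 != p.2)
  (fun p => `|row p.1 X - row p.2 X|)).
Qed.

(** Beyond some spread [M] the values are below 1. Otherwise translation invariance allows row 0 to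
    be moved to the origin, which puts all rows in a ball of radius [M]; flattening by [mxvec] then
    gives a compact set. *)
Lemma calF_bounded k (f : 'M[R]_(k.+1, d) -> R) : calF f ->
  exists B : R, forall X, `|f X| <= B.
Proof.
move=> [cf invf /(_ 1 ltr01)[M HM]].
pose g (u : 'rV[R]_(k.+1 * d)) := f (vec_mx u).
have cg : continuous g.
  have cv : continuous (vec_mx : 'rV[R]_(k.+1 * d) -> 'M[R]_(k.+1, d)).
    apply: (@lipschitz_continuous _ _ _ _ 1) => u v; rewrite mul1r.
    apply: mx_norm_leP => // i j; rewrite !mxE.
    by have := ler_mx_entry (u - v) ord0 (mxvec_index i j); rewrite !mxE.
  by move=> u; apply: continuous_comp; [exact: cv|exact: cf].
pose K := [set u : 'rV[R]_(k.+1 * d) | `|u| <= `|M|].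
have cK : compact K.
  apply: bounded_closed_compact.
    by exists `|M|; split=> // b Mb u /= uM; rewrite (le_trans uM)// ltW.
  apply: (@closed_comp _ _ (fun u : 'rV[R]_(k.+1 * d) => `|u|) [set t | t <= `|M|]).
    by move=> u _; exact: norm_continuous.
  exact: closed_le.
have /compact_bounded[B [_ HB]] : compact (g @` K).
  by apply: continuous_compact => //; exact: continuous_subspaceT.
exists (Num.max 1 (B + 1)) => X.
have [MX|XM] := ltP M (spread X); first by rewrite le_max ltW// HM.
rewrite le_max; apply/orP; right.
pose Y := X + \matrix_(i < k.+1) (- row ord0 X).
rewrite -[f X](invf (- row ord0 X)) -[X + _]/Y.
rewrite -[Y]mxvecK; apply: (HB (B + 1)); first by rewrite ltrDl.
exists (mxvec Y) => //; rewrite /K /=.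
apply: mx_norm_leP => // a j; rewrite (ord1 a).
case/mxvec_indexP: j => i j; rewrite mxvecE !mxE.
have [->|i0] := eqVneq i ord0; first by rewrite subrr normr0.
apply: le_trans (ler_norm M); apply: le_trans XM.
apply: le_trans (ler_spread X i0).
by apply: le_trans (ler_mx_entry _ ord0 j); rewrite !mxE.
Qed.

(** The Lipschitz bound passes to [corr phi], and the bounded support makes [star] vanish at
    infinity. *)
Definition bump (phi : 'rV[R]_d -> R) : Prop :=
  [/\ forall x, 0 <= phi x <= 1,
      exists L, forall x y, `|phi x - phi y| <= L * `|x - y| &
      exists r, forall x, r < `|x| -> phi x = 0].

Lemma bump_continuous phi : bump phi -> continuous phi.
Proof. by case=> _ [L HL] _; exact: (lipschitz_continuous HL). Qed.

Lemma bump0 : bump (fun=> 0).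
Proof.
split=> [x|| ]; first by rewrite lexx ler01.
  by exists 0 => x y; rewrite subrr normr0 mul0r.
by exists 0.
Qed.

Lemma bump_cup phi psi : bump phi -> bump psi ->
  bump (fun x => 1 - (1 - phi x) * (1 - psi x)).
Proof.
move=> [phi01 [L HL] [r Hr]] [psi01 [L' HL'] [r' Hr']]; split=> [x|| ].
- by move: (phi01 x) (psi01 x); nra.
- exists (L + L') => x y.
  rewrite (_ : _ - _ =
    (phi x - phi y) * (1 - psi x) + (psi x - psi y) * (1 - phi y)); last by ring.
  apply: le_trans (ler_normD _ _) _; rewrite [leRHS]mulrDl !normrM.
  have h (t : R) : 0 <= t <= 1 -> `|1 - t| <= 1 by move=> /andP[? ?]; rewrite ger0_norm; lra.
  by apply: lerD; rewrite -[leRHS]mulr1 ler_pM// h.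
- exists (Num.max r r') => x; rewrite gt_max => /andP[rx r'x].
  by rewrite Hr// Hr'// subr0 mulr1 subrr.
Qed.

Definition star n (phi_ : nat -> 'rV[R]_d -> R) (X : 'M[R]_(n.+1, d)) : R :=
  \prod_(j < n) phi_ j (row (lift ord0 j) X - row ord0 X).

(** Only differences with row 0 occur, whence the invariance. If [r] bounds the supports of the [n]
    bumps, a spread above [r + r] forces some row to be farther than [r] from row 0, and the
    corresponding factor is 0. *)
Lemma calF_star n phi_ : (forall j, bump (phi_ j)) -> calF (@star n phi_).
Proof.
move=> bphi; split.
- apply: continuous_big; first exact: mul_continuous.
  move=> j _ X.
  apply: (@continuous_comp _ _ _ (fun X => row (lift ord0 j) X - row ord0 X) (phi_ j)).
    apply: (@lipschitz_continuous _ _ _ _ 2) => {}X Y.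
    rewrite (_ : row _ X - _ - _ = row (lift ord0 j) (X - Y) - row ord0 (X - Y)); last first.
      by apply/rowP => a; rewrite !mxE; ring.
    apply: le_trans (ler_normB _ _) _.
    by rewrite mulr_natl mulr2n lerD// ler_norm_row.
  exact/bump_continuous.
- move=> y X; apply: eq_bigr => j _; congr (phi_ j _).
  by apply/rowP => a; rewrite !mxE; ring.
- have [r [r0 Hr]] : exists r, 0 <= r /\ forall j x, (j < n)%N -> r < `|x| -> phi_ j x = 0.
    elim: n => [|n [r [r0 Hr]]]; first by exists 0.
    have [_ _ [r' Hr']] := bphi n; exists (Num.max r r'); split=> [|j x].
      by rewrite le_max r0.
    rewrite ltnS leq_eqVlt gt_max => /predU1P[->|jn] /andP[rx r'x]; first exact: Hr'.
    exact: Hr.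
  move=> e e0; exists (r + r) => X Xr.
  suff [j jX] : exists j : 'I_n, r < `|row (lift ord0 j) X - row ord0 X|.
    by rewrite /star (bigD1 j)//= Hr// mul0r normr0.
  apply/not_existsP => H; move: Xr; apply/negP; rewrite -leNgt.
  have Hn i : `|row i X - row ord0 X| <= r.
    have [j ->|->] := unliftP ord0 i; last by rewrite subrr normr0.
    by rewrite leNgt; apply/negP; exact: H.
  apply/bigmax_leP; split=> [|[p q] _ /=]; first exact: addr_ge0.
  apply: le_trans (ler_distD (row ord0 X) _ _) _.
  by apply: lerD; rewrite // distrC.
Qed.

End test_functions.

(** * Integrals and translations *)

Section bounded_integral.
Context {R : realType} {d : measure_display} {T : measurableType d}.
Variable mu : {finite_measure set T -> \bar R}.
Implicit Types (h : T -> R) (B : R).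

Lemma bounded_integrable h B : measurable_fun setT h -> (forall x, `|h x| <= B) ->
  mu.-integrable setT (EFin \o h).
Proof.
move=> mh hB; apply: measurable_bounded_integrable => //.
  by rewrite ltey_eq fin_num_measure.
by exists B; split=> [|b Bb x _]; [exact: num_real|exact: le_trans (hB x) (ltW Bb)].
Qed.

Lemma ler_norm_Rintegral h B : measurable_fun setT h -> (forall x, `|h x| <= B) ->
  `|\int[mu]_x h x| <= B * fine (mu setT).
Proof.
move=> mh hB; have ih := bounded_integrable mh hB.
apply: le_trans (le_normr_Rintegral measurableT ih) _.
rewrite -Rintegral_cst//; apply: le_Rintegral => //.
  by apply: (@bounded_integrable _ B) => [|x]; [exact: measurableT_comp|rewrite normr_id].
by apply: (@bounded_integrable _ `|B|) => [|x]; [exact: measurable_cst|].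
Qed.

Lemma cvg_Rintegral_bounded (h_ : nat -> T -> R) h B :
  (forall n, measurable_fun setT (h_ n)) -> (forall n x, `|h_ n x| <= B) ->
  (forall x, h_ ^~ x @ \oo --> h x) ->
  (fun n => \int[mu]_x h_ n x) @ \oo --> \int[mu]_x h x.
Proof.
move=> mh_ hB hh.
have mh : measurable_fun setT h.
  by apply: (measurable_fun_cvg mh_) => x _; exact: hh.
have [|||||ih _ ic] := @dominated_convergence _ _ _ mu setT measurableT
  (fun n => EFin \o h_ n) (EFin \o h) (EFin \o cst B).
- by move=> n; exact/measurable_EFinP.
- exact/measurable_EFinP.
- by apply: aeW => x _; apply: cvg_EFin; [exact: nearW|exact: hh].
- by apply: (@bounded_integrable _ `|B|) => [|x]; [exact: measurable_cst|].
- by apply: aeW => x n _; rewrite lee_fin hB.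
apply/fine_cvg; rewrite fineK; first exact: ic.
exact: integrable_fin_num.
Qed.

End bounded_integral.

Section translations.
Context {R : realType} {d : nat}.
Implicit Types (alpha beta : subprob R d) (v x : 'rV[R]_d).

Definition translation v (x : Rd R d) : Rd R d := (x : 'rV[R]_d) + v.

Lemma measurable_preimage_translation v (A : set (Rd R d)) :
  measurable A -> measurable (translation v @^-1` A).
Proof. by move=> mA; rewrite -[X in measurable X]setTI; exact: measurable_translation. Qed.

(** The product measure integrates over [x] the point mass at [v] of the section at [x], which is
    the indicator of [x + v] lying in [A]. *)
Lemma translateE alpha v (A : set (Rd R d)) : measurable A ->
  translate alpha v A = alpha (translation v @^-1` A).
Proof.
move=> mA; rewrite /translate /pushforward /product_measure1.
have -> : alpha (translation v @^-1` A) =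
    (\int[alpha]_x (\1_(translation v @^-1` A) x)%:E)%E.
  by rewrite integral_indic ?setIT//; exact: measurable_preimage_translation.
by apply: eq_integral => x _ /=; rewrite diracE indicE; congr (_%:R%:E); rewrite mem_xsection.
Qed.

Lemma measure_orbitP alpha beta : measure_orbit alpha beta <->
  exists v, forall A, measurable A -> beta A = alpha (translation v @^-1` A).
Proof.
by split=> -[v H]; exists v => A mA; rewrite H// translateE.
Qed.

Lemma measure_orbit_sym alpha beta : measure_orbit alpha beta -> measure_orbit beta alpha.
Proof.
move=> /measure_orbitP[v H]; apply/measure_orbitP; exists (- v) => A mA.
rewrite H; last exact: measurable_preimage_translation.
by congr (alpha _); apply/funext => x; rewrite /preimage /= /translation addrK.
Qed.

Lemma measure_orbit_trans alpha beta gamma : measure_orbit alpha beta ->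
  measure_orbit beta gamma -> measure_orbit alpha gamma.
Proof.
move=> /measure_orbitP[v H] /measure_orbitP[w H']; apply/measure_orbitP.
exists (v + w) => A mA; rewrite H'// H; last exact: measurable_preimage_translation.
by congr (alpha _); apply/funext => x; rewrite /preimage /= /translation addrA.
Qed.

Lemma measure_orbit_refl alpha : measure_orbit alpha alpha.
Proof.
apply/measure_orbitP; exists 0 => A mA.
by congr (alpha _); apply/funext => x; rewrite /preimage /= /translation addr0.
Qed.

Lemma measure_orbit_eqP alpha beta :
  measure_orbit alpha = measure_orbit beta <-> measure_orbit alpha beta.
Proof.
split=> [->|ab]; first exact: measure_orbit_refl.
apply/seteqP; split=> g /=; last exact: measure_orbit_trans.
exact/measure_orbit_trans/measure_orbit_sym.
Qed.

Lemma giry_int_translation alpha beta v (h : Rd R d -> \bar R) :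
  (forall A, measurable A -> beta A = alpha (translation v @^-1` A)) ->
  measurable_fun setT h -> (forall x, 0 <= h x)%E ->
  giry_int beta h = giry_int alpha (h \o translation v).
Proof.
move=> H mh h0.
rewrite -(giry_int_map (measurable_translation v) alpha)//.
by apply: eq_measure_integral => A mA _; rewrite /= H.
Qed.

End translations.

(** * Integrals against powers of a measure *)

Section power_measure.
Context {R : realType} {d : measure_display} {T : measurableType d}.
Implicit Types alpha : subprobability T R.

(** Tonelli splits off the first variable; this is the step of the inductions on the power. *)
Lemma giry_int_power_succ alpha n (h : n.+1.-tuple T -> \bar R) :
  measurable_fun setT h -> (forall t, 0 <= h t)%E ->
  giry_int (power_measure alpha n.+1) h =
  giry_int alpha (fun x => giry_int (power_measure alpha n)
    (fun t => h [the n.+1.-tuple T of x :: t])).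
Proof.
move=> mh h0 /=; rewrite giry_int_map// giry_int_prod1//.
- exact: (measurableT_comp mh (@measurable_cons_pair _ T n)).
- by move=> x; exact: h0.
Qed.

(** All factors but one have mass at most 1. A bound linear in the mass of [alpha] is what makes
    sums over a collection converge. *)
Lemma power_measure_setT alpha n :
  (power_measure alpha n.+1 setT <= alpha setT)%E.
Proof.
rewrite /= /giry_map /pushforward /= preimage_setT.
rewrite -setXTT [leLHS]product_measure1E//=.
by rewrite -[leRHS]mule1 lee_pmul// sprobability_setT.
Qed.

End power_measure.

Section integral_power.
Context {R : realType} {d : nat}.
Implicit Types (alpha beta : subprob R d).

Definition mass alpha : R := fine (alpha setT).

Lemma mass_ge0 alpha : 0 <= mass alpha.
Proof. by rewrite /mass fine_ge0. Qed.

Lemma massE alpha : (mass alpha)%:E = alpha setT.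
Proof. by rewrite /mass fineK// fin_num_measure. Qed.

Lemma mass_le1 alpha : mass alpha <= 1.
Proof. by rewrite -lee_fin massE sprobability_setT. Qed.

Lemma mass_orbit alpha beta : measure_orbit alpha beta -> mass beta = mass alpha.
Proof. by move=> /measure_orbitP[v H]; rewrite /mass H. Qed.

Lemma integral_powerE k (g : 'M[R]_(k, d) -> R) alpha :
  integral_power (existT _ k g) alpha =
  \int[power_measure alpha k]_t g (\matrix_(i < k) (tnth t i : 'rV[R]_d)).
Proof. by []. Qed.

Lemma ler_norm_integral_power k (g : 'M[R]_(k.+1, d) -> R) B alpha :
  continuous g -> (forall X, `|g X| <= B) ->
  `|integral_power (existT _ k.+1 g) alpha| <= B * mass alpha.
Proof.
move=> cg gB.
apply: le_trans (ler_norm_Rintegral _ (continuous_measurable_tuple cg) _) _.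
  by move=> t; exact: gB.
apply: ler_wpM2l; first exact: le_trans (gB 0).
rewrite -lee_fin massE fineK; first exact: power_measure_setT.
exact: fin_num_measure.
Qed.

Lemma integral_powerB k (g h : 'M[R]_(k.+1, d) -> R) B C alpha :
  continuous g -> continuous h -> (forall X, `|g X| <= B) ->
  (forall X, `|h X| <= C) ->
  integral_power (existT _ k.+1 g) alpha - integral_power (existT _ k.+1 h) alpha
  = integral_power (existT _ k.+1 (g \- h)) alpha.
Proof.
move=> cg ch gB hC; rewrite !integral_powerE -RintegralB//.
- by apply: bounded_integrable (continuous_measurable_tuple cg) _ => t; exact: gB.
- by apply: bounded_integrable (continuous_measurable_tuple ch) _ => t; exact: hC.
Qed.

Lemma measurable_map_translation k (v : 'rV[R]_d) :
  measurable_fun [set: k.-tuple (Rd R d)] (fun t => map_tuple (translation v) t).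
Proof.
apply/measurable_fun_tnthP => i.
rewrite (_ : _ \o _ = translation v \o (fun t => tnth t i)); last first.
  by apply/funext => t /=; rewrite tnth_map.
by apply: measurableT_comp; [exact: measurable_translation|exact: measurable_tnth].
Qed.

(** One variable is translated at a time. Nonnegativity allows Tonelli without integrability; signed
    integrands are treated afterwards through their positive and negative parts. *)
Lemma giry_int_power_translation alpha beta v k (h : k.-tuple (Rd R d) -> \bar R) :
  (forall A, measurable A -> beta A = alpha (translation v @^-1` A)) ->
  measurable_fun setT h -> (forall x, 0 <= h x)%E ->
  giry_int (power_measure beta k) h =
  giry_int (power_measure alpha k) (fun t => h (map_tuple (translation v) t)).
Proof.
move=> H; elim: k => [|k IH] in h *; move=> mh h0.
  rewrite !giry_int_ret//; last exact: (measurableT_comp mh (measurable_map_translation v)).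
  by congr h; apply/val_inj.
rewrite !giry_int_power_succ//; last first.
  exact: (measurableT_comp mh (measurable_map_translation v)).
have mc : measurable_fun setT
    (fun p : Rd R d * k.-tuple (Rd R d) => h [the k.+1.-tuple _ of p.1 :: p.2]).
  exact: (measurableT_comp mh (@measurable_cons_pair _ _ k)).
rewrite (giry_int_translation H); last 2 first.
- exact: (measurable_fun_fubini_tonelli_F (m2 := power_measure beta k) _ mc (fun p => h0 _)).
- by move=> x; exact: integral_ge0.
apply: eq_integral => x _ /=; rewrite IH//.
- by apply: eq_integral => t _; congr h; apply/val_inj.
- exact: (measurableT_comp mc (pair1_measurable (translation v x))).
Qed.

Lemma integral_power_orbit k (g : 'M[R]_(k, d) -> R) alpha beta :
  continuous g -> translation_invariant g -> measure_orbit alpha beta ->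
  integral_power (existT _ k g) beta = integral_power (existT _ k g) alpha.
Proof.
move=> cg invg /measure_orbitP[v H]; rewrite !integral_powerE.
have mg := continuous_measurable_tuple cg.
have gE t : g (\matrix_(i < k) (tnth (map_tuple (translation v) t) i : 'rV[R]_d)) =
            g (\matrix_(i < k) (tnth t i : 'rV[R]_d)).
  rewrite -[RHS](invg v); congr g; apply/matrixP => i j.
  by rewrite !mxE tnth_map mxE.
congr fine; rewrite [LHS]integralE [RHS]integralE; congr (_ - _)%E.
- rewrite -!/(giry_int _ _) (giry_int_power_translation H)//; last first.
    exact/measurable_funepos/measurable_EFinP.
  by apply: eq_integral => t _; rewrite !funeposE /= gE.
- rewrite -!/(giry_int _ _) (giry_int_power_translation H)//; last first.
    exact/measurable_funeneg/measurable_EFinP.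
  by apply: eq_integral => t _; rewrite !funenegE /= gE.
Qed.

End integral_power.

(** * Correlations of a measure with bumps *)

Section correlation.
Context {R : realType} {d : nat}.
Implicit Types (alpha beta : subprob R d) (phi : 'rV[R]_d -> R) (v x : 'rV[R]_d).

Definition corr phi (b : subprob R d * 'rV[R]_d) : R :=
  \int[b.1]_y phi ((y : 'rV[R]_d) - b.2).

Lemma measurable_bump phi x : bump phi ->
  measurable_fun [set: Rd R d] (fun y => phi ((y : 'rV[R]_d) - x)).
Proof.
move=> bphi.
exact: (measurableT_comp (continuous_measurable_Rd (bump_continuous bphi))
  (measurable_translation (- x))).
Qed.

Lemma bump_norm phi x : bump phi -> `|phi x| <= 1.
Proof. by case=> /(_ x)/andP[p0 p1] _ _; rewrite ger0_norm. Qed.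

Lemma integrable_bump phi alpha x : bump phi ->
  alpha.-integrable setT (EFin \o (fun y => phi ((y : 'rV[R]_d) - x))).
Proof.
by move=> bphi; apply: (@bounded_integrable _ _ _ _ _ 1) => [|y];
  [exact: measurable_bump|exact: bump_norm].
Qed.

Lemma corr_ge0 phi b : bump phi -> 0 <= corr phi b.
Proof. by move=> [H _ _]; apply: Rintegral_ge0 => y _; case/andP: (H (y - b.2)). Qed.

Lemma corr_norm phi b : bump phi -> `|corr phi b| <= 1.
Proof.
move=> bphi; apply: le_trans (@ler_norm_Rintegral _ _ _ _ _ 1 (measurable_bump b.2 bphi) _) _.
  by move=> y; exact: bump_norm.
by rewrite mul1r; exact: mass_le1.
Qed.

(** The Lipschitz constant of [phi] survives integration since [alpha] has mass at most 1. *)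
Lemma corr_lipschitz phi alpha : bump phi -> exists L, 0 <= L /\
  forall x y, `|corr phi (alpha, x) - corr phi (alpha, y)| <= L * `|x - y|.
Proof.
move=> bphi; have [_ [L HL] _] := bphi; exists `|L|; split=> // x y.
rewrite /corr /= -RintegralB//; [|exact: integrable_bump..].
apply: le_trans (@ler_norm_Rintegral _ _ _ _ _ (`|L| * `|x - y|) _ _) _.
- by apply: measurable_funB; exact: measurable_bump.
- move=> z; apply: le_trans (HL _ _) _.
  rewrite opprB addrC addrA subrK (distrC y).
  by apply: ler_wpM2r => //; exact: ler_norm.
- by rewrite -[leRHS]mulr1; apply: ler_wpM2l; [exact: mulr_ge0|exact: mass_le1].
Qed.

Lemma measurable_corr phi alpha : bump phi ->
  measurable_fun [set: Rd R d] (fun x => corr phi (alpha, x : 'rV[R]_d)).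
Proof.
move=> /(corr_lipschitz alpha)[L [_ HL]].
apply: continuous_measurable_Rd; exact: (lipschitz_continuous HL).
Qed.

Lemma EFin_corr phi alpha x : bump phi ->
  (corr phi (alpha, x))%:E = (\int[alpha]_y (phi ((y : 'rV[R]_d) - x))%:E)%E.
Proof.
move=> bphi; rewrite /corr /Rintegral fineK//.
exact: (integrable_fin_num measurableT (integrable_bump alpha x bphi)).
Qed.

Lemma giry_int_prod_bump n (phi_ : nat -> 'rV[R]_d -> R) alpha x :
  (forall j, bump (phi_ j)) ->
  giry_int (power_measure alpha n)
    (fun t => (\prod_(j < n) phi_ j ((tnth t j : 'rV[R]_d) - x))%:E) =
  (\prod_(j < n) corr (phi_ j) (alpha, x))%:E.
Proof.
move=> bphi.
have phi0 j y : 0 <= phi_ j y by have [/(_ y)/andP[]] := bphi j.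
have mp m (psi_ : nat -> 'rV[R]_d -> R) : (forall j, bump (psi_ j)) ->
    measurable_fun [set: m.-tuple (Rd R d)]
    (fun t => (\prod_(j < m) psi_ j ((tnth t j : 'rV[R]_d) - x))%:E).
  move=> bpsi; apply/measurable_EFinP; apply: measurable_prod => j _.
  exact: (measurableT_comp (measurable_bump x (bpsi j)) (measurable_tnth j)).
elim: n => [|n IH] in phi_ bphi phi0 *.
  by rewrite giry_int_ret ?big_ord0//; exact: mp.
rewrite giry_int_power_succ; last 2 first.
- exact: mp.
- by move=> t; rewrite lee_fin prodr_ge0.
under [LHS]eq_integral => y _.
  rewrite (_ : giry_int _ _ = ((phi_ 0%N (y - x))%:E *
     (\prod_(j < n) corr (phi_ j.+1) (alpha, x))%:E)%E); last first.
    rewrite -(IH (fun j => phi_ j.+1))// -ge0_integralZl//.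
    - by apply: eq_integral => t _; rewrite -EFinM big_ord_recl/= tnth0;
        under eq_bigr do rewrite tnthS.
    - by apply: (mp n (fun j => phi_ j.+1)) => j.
    - by move=> t _; rewrite lee_fin prodr_ge0.
    - by rewrite lee_fin phi0.
  over.
rewrite ge0_integralZr//.
- by rewrite -EFin_corr// -EFinM big_ord_recl.
- by apply/measurable_EFinP; exact: (measurable_bump x (bphi 0%N)).
- by move=> y _; rewrite lee_fin phi0.
- by rewrite lee_fin prodr_ge0// => j _; exact: corr_ge0.
Qed.

(** Once the variable of row 0 is fixed at [x], each other variable occurs in a single factor, so
    the inner integral is a product of correlations at [x]. *)
Lemma integral_power_star n (phi_ : nat -> 'rV[R]_d -> R) alpha :
  (forall j, bump (phi_ j)) ->
  integral_power (existT _ n.+1 (@star R d n phi_)) alpha =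
  \int[alpha]_x \prod_(j < n) corr (phi_ j) (alpha, x : 'rV[R]_d).
Proof.
move=> bphi; rewrite integral_powerE; congr fine.
have [cs _ _] := calF_star n bphi.
have phi0 j y : 0 <= phi_ j y by have [/(_ y)/andP[]] := bphi j.
rewrite -/(giry_int _ _) giry_int_power_succ; last 2 first.
- by apply/measurable_EFinP; exact: (continuous_measurable_tuple cs).
- by move=> t; rewrite lee_fin prodr_ge0.
apply: eq_integral => x _; rewrite -giry_int_prod_bump//.
apply: eq_integral => t _; congr (_%:E); apply: eq_bigr => j _.
congr (phi_ j _); apply/rowP => a.
by rewrite !mxE tnth0 tnthS.
Qed.

End correlation.

(** * Sums over a collection *)

Section collection_sum.
Context {R : realType} {d : nat}.
Implicit Types (xi : collection R d) (a b : nat -> R) (B : R).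

Definition csum xi a : R := limn (fun n => \sum_(0 <= i < n | i \in idx xi) a i).

Definition restrict_idx xi a i : R := if i \in idx xi then a i else 0.

(** As the masses sum to at most 1, this bound gives absolute convergence and a sum of norm at most
    [B] when [B] is nonnegative. *)
Definition dominated xi B a := forall i, idx xi i -> `|a i| <= B * mass (member xi i).

Lemma csumE xi a : csum xi a = limn (series (restrict_idx xi a)).
Proof. by congr (limn _); apply/funext => n; rewrite /series /= big_mkcond. Qed.

Lemma restrict_idx_norm xi B a i : dominated xi B a ->
  `|restrict_idx xi a i| <= B * restrict_idx xi (fun i => mass (member xi i)) i.
Proof.
move=> aB; rewrite /restrict_idx; case: ifPn => [|_]; last by rewrite normr0 mulr0.
by rewrite inE; exact: aB.
Qed.

Lemma restrict_mass_ge0 xi i : 0 <= restrict_idx xi (fun i => mass (member xi i)) i.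
Proof. by rewrite /restrict_idx; case: ifPn => // _; exact: mass_ge0. Qed.

Lemma nneseries_mass xi :
  (\sum_(i <oo) (restrict_idx xi (fun i => mass (member xi i)) i)%:E <= 1)%E.
Proof.
apply: le_trans (total_mass_le1 xi).
rewrite nneseries_esumT; last by move=> i; rewrite lee_fin restrict_mass_ge0.
rewrite [leRHS]esum_mkcond; apply: le_esum => i _.
by rewrite /restrict_idx; case: ifP => // _; rewrite massE.
Qed.

Lemma cvg_series_mass xi :
  cvgn (series (restrict_idx xi (fun i => mass (member xi i)))).
Proof.
apply: nnseries_is_cvg => [i|]; first exact: restrict_mass_ge0.
exact: le_lt_trans (nneseries_mass xi) (ltry 1).
Qed.

Lemma cvg_csum_norm xi B a : dominated xi B a ->
  cvgn (series (fun i => `|restrict_idx xi a i|)).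
Proof.
move=> aB; have aB' : dominated xi `|B| a.
  by move=> i ii; apply: le_trans (aB i ii) _; rewrite ler_wpM2r ?mass_ge0 ?ler_norm.
apply: (series_le_cvg
  (v_ := `|B| *: restrict_idx xi (fun i => mass (member xi i)))) => [//|i|i|].
- by apply: mulr_ge0 => //; exact: restrict_mass_ge0.
- exact: restrict_idx_norm.
- exact/is_cvg_seriesZ/cvg_series_mass.
Qed.

Lemma cvg_csum xi B a : dominated xi B a -> cvgn (series (restrict_idx xi a)).
Proof. by move=> aB; apply: normed_cvg; exact: cvg_csum_norm aB. Qed.

Lemma eq_csum xi a b : (forall i, idx xi i -> a i = b i) -> csum xi a = csum xi b.
Proof.
move=> ab; rewrite /csum; congr (limn _); apply/funext => n.
by apply: eq_bigr => i; rewrite inE => /ab.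
Qed.

Lemma csumD xi B C a b : dominated xi B a -> dominated xi C b ->
  csum xi (fun i => a i + b i) = csum xi a + csum xi b.
Proof.
move=> aB bC; rewrite !csumE -lim_seriesD; [|exact: cvg_csum aB|exact: cvg_csum bC].
congr (limn (series _)); apply/funext => i; rewrite /restrict_idx fctE.
by case: ifP => // _; rewrite addr0.
Qed.

Lemma csumZ xi B c a : dominated xi B a ->
  csum xi (fun i => c * a i) = c * csum xi a.
Proof.
move=> aB; rewrite !csumE -[RHS]lim_seriesZ; last exact: cvg_csum aB.
congr (limn (series _)); apply/funext => i; rewrite /restrict_idx fctE.
by case: ifP => // _; rewrite [RHS]mulr0.
Qed.

Lemma csumB xi B C a b : dominated xi B a -> dominated xi C b ->
  csum xi (fun i => a i - b i) = csum xi a - csum xi b.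
Proof.
move=> aB bC; have bC' : dominated xi C (fun i => -1 * b i).
  by move=> i ii; rewrite mulN1r normrN; exact: bC.
rewrite -mulN1r -(csumZ _ bC) -(csumD aB bC').
by apply: eq_csum => i _; rewrite mulN1r.
Qed.

Lemma summable_csum xi B a : dominated xi B a ->
  summable setT (fun i => (restrict_idx xi a i)%:E).
Proof.
move=> aB; rewrite /summable -nneseries_esumT//.
apply: (@le_lt_trans _ _ (limn (series (fun i => `|restrict_idx xi a i|)))%:E);
  last exact: ltry.
rewrite -EFin_lim; last exact: cvg_csum_norm aB.
by rewrite le_eqVlt; apply/orP; left; apply/eqP; congr (limn _);
  apply/funext => n; rewrite /series /= sumEFin.
Qed.

(** As an integral against the counting measure, the sum is open to dominated convergence and to
    reordering. *)
Lemma EFin_csum xi B a : dominated xi B a ->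
  (csum xi a)%:E = (\int[counting]_i (restrict_idx xi a i)%:E)%E.
Proof.
move=> aB; rewrite integral_count; last exact: summable_csum aB.
rewrite csumE -EFin_lim; last exact: cvg_csum aB.
by congr (limn _); apply/funext => n; rewrite /series /= sumEFin.
Qed.

Lemma csum_norm xi B a : 0 <= B -> dominated xi B a -> `|csum xi a| <= B.
Proof.
move=> B0 aB; rewrite csumE; apply: le_trans (lim_series_norm (cvg_csum_norm aB)) _.
have cm := @cvg_series_mass xi.
apply: le_trans (lim_series_le (cvg_csum_norm aB)
  (is_cvg_seriesZ (k := B) cm) (fun n => restrict_idx_norm n aB)) _.
rewrite lim_seriesZ// -[leRHS]mulr1; apply: ler_wpM2l => //.
rewrite -lee_fin; apply: le_trans (nneseries_mass xi); rewrite -EFin_lim//.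
by rewrite le_eqVlt; apply/orP; left; apply/eqP; congr (limn _);
  apply/funext => n; rewrite /series /= sumEFin.
Qed.

Lemma cvg_csum_dominated xi B (a_ : nat -> nat -> R) a :
  (forall n, dominated xi B (a_ n)) -> (forall i, idx xi i -> a_ ^~ i @ \oo --> a i) ->
  (fun n => csum xi (a_ n)) @ \oo --> csum xi a.
Proof.
move=> aB aa.
have aB' : dominated xi B a.
  move=> i ii; have ci : cvg ((fun n => `|a_ n i|) @ \oo).
    by apply/cvg_ex; exists `|a i|; exact: (cvg_norm (aa i ii)).
  rewrite -(cvg_lim _ (cvg_norm (aa i ii)))//; apply: limr_le => //.
  by apply: nearW => n; exact: aB.
pose m i := restrict_idx xi (fun i => mass (member xi i)) i.
have dm : dominated xi B (fun i => B * mass (member xi i)).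
  move=> i ii; rewrite ger0_norm//; apply: le_trans (aB 0%N i ii); exact: normr_ge0.
have := @dominated_convergence _ _ _ (counting : {measure set nat -> \bar R}) setT measurableT
  (fun n i => (restrict_idx xi (a_ n) i)%:E) (fun i => (restrict_idx xi a i)%:E)
  (fun i => (restrict_idx xi (fun i => B * mass (member xi i)) i)%:E).
case=> //.
- apply: aeW => i _; apply: cvg_EFin; first exact: nearW.
  rewrite /= /comp /=.
  rewrite /restrict_idx; case: ifPn => [|_]; last exact: cvg_cst.
  by rewrite inE => /aa.
- apply/integrableP; split => //.
  rewrite ge0_integral_count//.
  rewrite nneseries_esumT//; exact: (summable_csum dm).
- apply: aeW => i n _; rewrite lee_fin /restrict_idx.
  case: ifPn => [|_]; last by rewrite normr0.
  by rewrite inE => ?; exact: aB.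
move=> _ _ H.
have {}H : (fun n => (csum xi (a_ n))%:E) @ \oo --> (csum xi a)%:E.
  rewrite (EFin_csum aB'); under eq_fun do rewrite (EFin_csum (aB _)).
  exact: H.
exact: (fine_cvg H).
Qed.

End collection_sum.

(** * Multiplicities of orbits *)

Section multiplicities.
Context {R : realType} {d : nat}.
Implicit Types (xi : collection R d) (alpha beta : subprob R d) (A : subprob R d -> R).

(** Sums of positive and negative parts over a set do not depend on an ordering, so they can be
    reindexed by a bijection. Members of mass 0 drop out because the bound forces [A] to vanish
    there. *)
Lemma csum_esum xi A B : (forall alpha, `|A alpha| <= B * mass alpha) ->
  let P := [set i | idx xi i /\ mass (member xi i) != 0] in
  (csum xi (A \o member xi))%:E =
  (\esum_(i in P) (Num.max (A (member xi i)) 0)%:E -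
   \esum_(i in P) (Num.max (- A (member xi i)) 0)%:E)%E.
Proof.
move=> AB P.
have dA : dominated xi B (A \o member xi) by move=> i _; exact: AB.
rewrite (EFin_csum dA) integral_count; last exact: summable_csum dA.
have tT : (fun x : nat => is_true (xpredT x)) = setT by apply/seteqP; split.
rewrite (summable_eseries_esum (P := xpredT)); last first.
  by rewrite tT; exact: summable_csum dA.
rewrite tT.
have A0 i : idx xi i -> i \notin P -> A (member xi i) = 0.
  move=> ii; rewrite notin_setE /P /= => /not_andP[//|/negP]; rewrite negbK => /eqP m0.
  by have := AB (member xi i); rewrite m0 mulr0 normr_le0 => /eqP.
congr (_ - _)%E; rewrite [RHS]esum_mkcond; apply: eq_esum => i _.
- rewrite funeposE /restrict_idx; case: ifPn => ii; last first.
    by case: ifPn => [|_]; [rewrite inE => -[] /mem_set; rewrite (negbTE ii)|rewrite maxxx].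
  move: (ii); rewrite inE => ii'; rewrite EFin_max /=.
  by case: ifPn => // /(A0 _ ii') ->; rewrite maxxx.
- rewrite funenegE /restrict_idx; case: ifPn => ii; last first.
    by case: ifPn => [|_]; [rewrite inE => -[] /mem_set; rewrite (negbTE ii)|
      rewrite -EFinN oppr0 maxxx].
  move: (ii); rewrite inE => ii'; rewrite EFin_max /=.
  by case: ifPn => // /(A0 _ ii') ->; rewrite ?oppr0 -?EFinN ?oppr0 maxxx.
Qed.

(** The bijections between occurrences are glued over all orbits of nonzero mass. They are chosen
    per orbit, as a set, so that two members in the same orbit use the same bijection. *)
Lemma same_orbits_bij xi1 xi2 : same_orbits xi1 xi2 -> exists e : nat -> nat,
  set_bij [set i | idx xi1 i /\ mass (member xi1 i) != 0]
          [set i | idx xi2 i /\ mass (member xi2 i) != 0] e /\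
  forall i, idx xi1 i -> mass (member xi1 i) != 0 ->
    measure_orbit (member xi1 i) (member xi2 (e i)).
Proof.
move=> /asboolP same.
have mass_neq0 alpha : mass alpha != 0 -> alpha setT != 0%E.
  by apply: contra_neq => a0; rewrite /mass a0.
have H o : exists e : nat -> nat,
    (exists alpha, mass alpha != 0 /\ measure_orbit alpha = o) ->
    set_bij (occurrences xi1 o) (occurrences xi2 o) e.
  have [[alpha [a0 <-]]|no]  :=
      pselect (exists alpha, mass alpha != 0 /\ measure_orbit alpha = o).
    by have /card_set_bijP[e he] := same alpha (mass_neq0 _ a0); exists e.
  by exists id => /no.
have [h hP] := choice H.
pose e i := h (measure_orbit (member xi1 i)) i.
have eP i : idx xi1 i -> mass (member xi1 i) != 0 ->
    set_bij (occurrences xi1 (measure_orbit (member xi1 i)))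
      (occurrences xi2 (measure_orbit (member xi1 i))) (h (measure_orbit (member xi1 i))).
  by move=> ii i0; apply: hP; exists (member xi1 i).
have eO i : idx xi1 i -> mass (member xi1 i) != 0 ->
    idx xi2 (e i) /\ measure_orbit (member xi2 (e i)) = measure_orbit (member xi1 i).
  by move=> ii i0; have [sub _ _] := eP i ii i0; apply: sub.
exists e; split; last first.
  by move=> i ii i0; have [_ eo] := eO i ii i0; apply/measure_orbit_eqP.
split.
- move=> i [ii i0]; have [? eo] := eO i ii i0; split => //.
  by move/esym/measure_orbit_eqP/mass_orbit: eo => ->.
- move=> i j; rewrite !inE => -[ii i0] [jj j0] eij.
  have [_ ei] := eO i ii i0; have [_ ej] := eO j jj j0.
  have oij : measure_orbit (member xi1 i) = measure_orbit (member xi1 j).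
    by rewrite -ei -ej eij.
  have [_ inj _] := eP i ii i0; apply: inj; rewrite ?inE//.
  by move: eij; rewrite /e -oij.
- move=> j [jj j0]; have /(hP _)[_ _ surj] : exists alpha, mass alpha != 0 /\
      measure_orbit alpha = measure_orbit (member xi2 j) by exists (member xi2 j).
  have [i [ii io] hi] := surj j (conj jj erefl).
  exists i; last by rewrite /e io.
  by split => //; move/esym/measure_orbit_eqP/mass_orbit: io => ->.
Qed.

Lemma csum_same_orbits xi1 xi2 A B :
  (forall alpha, `|A alpha| <= B * mass alpha) ->
  (forall alpha beta, measure_orbit alpha beta -> A beta = A alpha) ->
  same_orbits xi1 xi2 -> csum xi1 (A \o member xi1) = csum xi2 (A \o member xi2).
Proof.
move=> AB Ao /same_orbits_bij[e [be eo]].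
apply: EFin_inj; rewrite !(csum_esum _ AB).
by congr (_ - _)%E; rewrite [RHS](reindex_esum _ _ _ _ be);
  apply: eq_esum => i [ii i0]; rewrite (Ao _ _ (eo i ii i0)).
Qed.

Lemma csum_orbit_mass xi alpha :
  (csum xi (fun i => \1_(measure_orbit alpha) (member xi i) * mass (member xi i)))%:E =
  ((mass alpha)%:E * counting (occurrences xi (measure_orbit alpha)))%E.
Proof.
have dA : dominated xi 1
    (fun i => \1_(measure_orbit alpha) (member xi i) * mass (member xi i)).
  move=> i _; rewrite normrM ler_pM//; last by rewrite ger0_norm// mass_ge0.
  by rewrite indicE normr_nat lern1 leq_b1.
rewrite (EFin_csum dA) -integral_cst// integral_mkcond.
apply: eq_integral => i _; rewrite /restrict_idx /patch.
have -> : (i \in occurrences xi (measure_orbit alpha)) =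
    (i \in idx xi) && (member xi i \in measure_orbit alpha).
  apply/idP/andP; rewrite !inE => -[ii]; split; rewrite ?inE//.
    by apply/measure_orbit_eqP.
  by apply/esym/measure_orbit_eqP.
case: ifPn => //= ii; rewrite indicE; case: ifPn => // ai; last by rewrite mul0r.
by rewrite mul1r; move: ai; rewrite inE => /mass_orbit ->.
Qed.

(** The sum is a real number and equals the positive mass times the multiplicity, so the
    multiplicity is finite and can be recovered by division. *)
Lemma card_occurrences xi1 xi2 alpha : mass alpha != 0 ->
  csum xi1 (fun i => \1_(measure_orbit alpha) (member xi1 i) * mass (member xi1 i)) =
  csum xi2 (fun i => \1_(measure_orbit alpha) (member xi2 i) * mass (member xi2 i)) ->
  (occurrences xi1 (measure_orbit alpha) #= occurrences xi2 (measure_orbit alpha))%card.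
Proof.
move=> a0 H; have a1 : 0 < mass alpha by rewrite lt0r a0 mass_ge0.
have fin xi : finite_set (occurrences xi (measure_orbit alpha)).
  have := csum_orbit_mass xi alpha; rewrite /counting.
  case: asboolP => // _; rewrite gt0_muley ?lte_fin//.
have := congr1 EFin H; rewrite !csum_orbit_mass /counting.
do 2 (rewrite asboolT; last exact: fin).
move=> [] /(mulfI a0)/eqP; rewrite eqr_nat => /eqP E.
exact/fcard_eq.
Qed.

End multiplicities.

(** * Bounded pointwise closure *)

Section bounded_closure.
Context {R : realType} {T : Type}.
Implicit Types (G : set (T -> R)) (g h : T -> R) (A : set T).

(** Limits may be nested arbitrarily, and each sequence has its own uniform bound, as dominated
    convergence requires. *)
Inductive bounded_closure G : (T -> R) -> Prop :=
| bc_base h of G h : bounded_closure G h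
| bc_add g h of bounded_closure G g & bounded_closure G h :
    bounded_closure G (fun b => g b + h b)
| bc_scale c h of bounded_closure G h : bounded_closure G (fun b => c * h b)
| bc_lim (h_ : nat -> T -> R) h B of
    (forall n, bounded_closure G (h_ n)) &
    (forall n b, `|h_ n b| <= B) &
    (forall b, h_ ^~ b @ \oo --> h b) : bounded_closure G h.

Lemma bc_bounded G : (forall h, G h -> exists B, forall b, `|h b| <= B) ->
  forall h, bounded_closure G h -> exists B, forall b, `|h b| <= B.
Proof.
move=> Gb h; elim=> {}h.
- exact: Gb.
- move=> g _ [B HB] _ [C HC]; exists (B + C) => b.
  by apply: le_trans (ler_normD _ _) _; exact: lerD.
- by move=> g _ [B HB]; exists (`|h| * B) => b; rewrite normrM ler_wpM2l.
- move=> g B _ _ HB Hl; exists B => b.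
  have /cvg_norm cn := Hl b.
  rewrite -(cvg_lim _ cn)//; apply: limr_le; first by apply/cvg_ex; exists `|g b|.
  by apply: nearW => n; exact: HB.
Qed.

Section algebra.
Variable G : set (T -> R).
Hypothesis G_bounded : forall h, G h -> exists B, forall b, `|h b| <= B.
Hypothesis G_mul : forall g h, G g -> G h -> G (fun b => g b * h b).

Lemma bc_eq g h : (forall b, g b = h b) -> bounded_closure G g -> bounded_closure G h.
Proof. by move=> /funext ->. Qed.

(** Two inductions: on the second factor while the first is in [G], then on the first factor. *)
Lemma bc_mul g h : bounded_closure G g -> bounded_closure G h ->
  bounded_closure G (fun b => g b * h b).
Proof.
have base (g' h' : T -> R) : G g' -> bounded_closure G h' ->
    bounded_closure G (fun b => g' b * h' b).
  move=> Gg; elim=> {}h'.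
  - by move=> Gh; apply: bc_base; exact: G_mul.
  - move=> k _ ? _ ?; apply: bc_eq (bc_add
      (g := fun b => g' b * h' b) (h := fun b => g' b * k b) _ _) => // b.
    by rewrite mulrDr.
  - move=> k _ ?; apply: bc_eq (bc_scale (h := fun b => g' b * k b) h' _) => // b.
    by rewrite mulrCA.
  - move=> k B _ IH HB Hl; have [C HC] := G_bounded Gg.
    apply: (bc_lim (h_ := fun n b => g' b * h' n b) (B := C * B)) => // [n b|b].
      by rewrite normrM ler_pM.
    by apply: cvgM; [exact: cvg_cst|exact: Hl].
move=> + bh; elim=> {}g.
- by move=> Gg; exact: base.
- move=> k _ ? _ ?; apply: bc_eq (bc_add
    (g := fun b => g b * h b) (h := fun b => k b * h b) _ _) => // b.
  by rewrite mulrDl.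
- move=> k _ ?; apply: bc_eq (bc_scale (h := fun b => k b * h b) g _) => // b.
  by rewrite mulrA.
- move=> k B _ IH HB Hl; have [C HC] := bc_bounded G_bounded bh.
  apply: (bc_lim (h_ := fun n b => g n b * h b) (B := B * C)) => // [n b|b].
    by rewrite normrM ler_pM.
  by apply: cvgM; [exact: Hl|exact: cvg_cst].
Qed.

Lemma bc_sub g h : bounded_closure G g -> bounded_closure G h ->
  bounded_closure G (fun b => g b - h b).
Proof.
move=> bg bh; apply: bc_eq (bc_add bg (bc_scale (- 1) bh)) => b.
by rewrite mulN1r.
Qed.

(** The functions [1 - (1 - m) ^+ n] are polynomials in [m] without constant term, so the constant 1
    need not belong to [G]; even the case [n = 0] is obtained as [0 * m]. *)
Lemma bc_support m : (forall b, 0 <= m b <= 1) -> bounded_closure G m ->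
  bounded_closure G (fun b => (m b != 0)%:R).
Proof.
move=> m01 bm; apply: (bc_lim (h_ := fun n b => 1 - (1 - m b) ^+ n) (B := 1)).
- elim=> [|n IH].
    by apply: bc_eq (bc_scale 0 bm) => b; rewrite expr0 mul0r subrr.
  apply: bc_eq (bc_add IH (bc_sub bm (bc_mul bm IH))) => b.
  by rewrite exprS; ring.
- move=> n b; have /andP[m0 m1] := m01 b.
  have p0 : 0 <= 1 - m b by rewrite subr_ge0.
  have p1 : 1 - m b <= 1 by rewrite gerBl.
  have := exprn_ge0 n p0; have := exprn_ile1 n p0 p1.
  by move=> h1 h2; rewrite ger0_norm ?subr_ge0// gerBl.
- move=> b; have [m0|m0] := eqVneq (m b) 0.
    rewrite m0; under eq_fun do rewrite subr0 expr1n subrr.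
    exact: cvg_cst.
  rewrite -[X in _ --> X](subr0 1); apply: cvgB; first exact: cvg_cst.
  apply: cvg_expr; have /andP[m00 m1] := m01 b.
  by rewrite ger0_norm ?subr_ge0// gtrBl lt0r m0.
Qed.

Hypothesis G_one : G (fun=> 1).

Lemma bc_cst c : bounded_closure G (fun=> c).
Proof. by apply: bc_eq (bc_scale c (bc_base G_one)) => b; rewrite mulr1. Qed.

(* The iteration [q := q + (u ^ 2 - q ^ 2) / 2] started at 0 consists of
   polynomials in [u] and increases to [`|u|]. *)
Fixpoint abs_approx n (u : R) : R :=
  if n is n'.+1 then
    abs_approx n' u + 2^-1 * (u * u - abs_approx n' u * abs_approx n' u)
  else 0.

(** With [v] the absolute value of [u], one iteration multiplies the error [v - q] by
    [1 - (v + q) / 2], which lies between 0 and [1 - v / 2]. *)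
Lemma abs_approxP n u : `|u| <= 1 ->
  0 <= abs_approx n u <= `|u| /\
  `|u| - abs_approx n u <= `|u| * (1 - 2^-1 * `|u|) ^+ n.
Proof.
move=> u1; have u0 := normr_ge0 u.
elim: n => [|n [/andP[q0 qu] IH]] /=.
  by rewrite lexx u0 subr0 expr0 mulr1.
have uu : u * u = `|u| * `|u| by rewrite -normrM ger0_norm// -expr2 sqr_ge0.
rewrite uu; set q := abs_approx n u in q0 qu IH *; set v := `|u| in u1 u0 qu IH *.
have E : v - (q + 2^-1 * (v * v - q * q)) = (v - q) * (1 - 2^-1 * (v + q)) by field.
split.
  apply/andP; split; first by nra.
  rewrite -subr_ge0 E; apply: mulr_ge0; lra.
rewrite E exprSr mulrA; apply: ler_pM => //; lra.
Qed.

Lemma abs_approx_cvg u : `|u| <= 1 -> abs_approx ^~ u @ \oo --> `|u|.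
Proof.
move=> u1; have u0 := normr_ge0 u.
(* At [u = 0] the ratio of the geometric bound is 1, so this case is separate; all iterates are then
   0. *)
have [uz|uz] := eqVneq `|u| 0.
  rewrite uz; apply: cvg_near_cst; apply: nearW => n.
  by have [/andP[q0]] := abs_approxP n u1; rewrite uz => q1 _; apply/eqP; rewrite eq_le q0 q1.
apply: (@squeeze_cvgr _ _ _ _ (fun n => `|u| - `|u| * (1 - 2^-1 * `|u|) ^+ n) (cst `|u|)).
- apply: nearW => n; have [/andP[q0 qu] qd] := abs_approxP n u1.
  by rewrite qu andbT /=; lra.
- rewrite -[X in _ --> X](subr0 `|u|); apply: cvgB; first exact: cvg_cst.
  rewrite -(mulr0 `|u|); apply: cvgM; first exact: cvg_cst.
  apply: cvg_expr; have : 0 < `|u| by rewrite lt0r uz.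
  by move=> u2; rewrite ger0_norm; lra.
- exact: cvg_cst.
Qed.

Lemma bc_abs h : (forall b, `|h b| <= 1) -> bounded_closure G h ->
  bounded_closure G (fun b => `|h b|).
Proof.
move=> h1 bh; apply: (bc_lim (h_ := fun n b => abs_approx n (h b)) (B := 1)).
- elim=> [|n IH]; first exact: bc_cst.
  apply: (bc_add IH); apply: bc_scale; apply: bc_sub; exact: bc_mul.
- move=> n b; have [/andP[q0 qu] _] := abs_approxP n (h1 b).
  by rewrite ger0_norm// (le_trans qu).
- by move=> b; exact: abs_approx_cvg.
Qed.

Definition bc_set A : Prop := bounded_closure G (fun b => \1_A b).

Lemma bc_setC A : bc_set A -> bc_set (~` A).
Proof.
move=> bA; apply: bc_eq (bc_sub (bc_cst 1) bA) => b.
by rewrite !indicE in_setC; case: (b \in A); rewrite ?subrr ?subr0.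
Qed.

Lemma bc_setI A A' : bc_set A -> bc_set A' -> bc_set (A `&` A').
Proof.
by move=> bA bA'; apply: bc_eq (bc_mul bA bA') => b; rewrite indicI.
Qed.

Lemma bc_bigcup (A_ : nat -> set T) : (forall n, bc_set (A_ n)) ->
  bc_set (\bigcup_n A_ n).
Proof.
move=> bA.
have bU n : bc_set (\big[setU/set0]_(i < n) A_ i).
  elim: n => [|n IH].
    by rewrite big_ord0; apply: bc_eq (bc_cst 0) => b; rewrite indic0.
  rewrite big_ord_recr /= -[X in bc_set X]setCK setCU.
  by apply/bc_setC/bc_setI; exact: bc_setC.
apply: (bc_lim (h_ := fun n b => \1_(\big[setU/set0]_(i < n) A_ i) b) (B := 1)) => //.
  by move=> n b; rewrite indicE normr_nat lern1 leq_b1.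
move=> b; rewrite indicE; have [|nb] := boolP (b \in \bigcup_n A_ n).
  rewrite inE => -[k _ Akb]; apply: cvg_near_cst; exists k.+1 => // n /= kn.
  by rewrite indicE mem_set// -bigcup_mkord; exists k.
apply: cvg_near_cst; apply: nearW => n; rewrite indicE memNset//.
by rewrite -bigcup_mkord => -[k _ Akb]; move: nb; rewrite notin_setE; apply; exists k.
Qed.

Lemma sigma_algebra_bc : sigma_algebra setT bc_set.
Proof.
split.
- by apply: bc_eq (bc_cst 0) => b; rewrite indic0.
- by move=> A bA; rewrite setTD; exact: bc_setC.
- exact: bc_bigcup.
Qed.

(** After scaling into [[-1, 1]], the positive part is half the sum of the function and its absolute
    value, and its support is the required set. *)
Lemma bc_set_gt0 h : bounded_closure G h -> bc_set [set b | 0 < h b].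
Proof.
move=> bh; have [B HB] := bc_bounded G_bounded bh.
have C0 : 0 < `|B| + 1 by rewrite ltr_pwDr.
pose k b := (`|B| + 1)^-1 * h b.
have k1 b : `|k b| <= 1.
  rewrite normrM normfV (gtr0_norm C0) ler_pdivrMl// mulr1.
  by apply: le_trans (HB b) _; rewrite (le_trans (ler_norm B))// lerDl.
have bk : bounded_closure G k by exact: bc_scale.
have bm : bounded_closure G (fun b => 2^-1 * (k b + `|k b|)).
  by apply/bc_scale/bc_add => //; exact: bc_abs.
apply: bc_eq (bc_support _ bm) => b; last first.
  have := k1 b; rewrite ler_norml => /andP[? ?].
  by case: (lerP 0 (k b)) => k0; [rewrite ger0_norm//|rewrite ltr0_norm//];
    apply/andP; split; lra.
rewrite indicE; congr (_%:R); congr nat_of_bool.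
have -> : (b \in [set b | 0 < h b]) = (0 < k b).
  rewrite /k pmulr_rgt0 ?invr_gt0//.
  by apply/idP/idP; rewrite inE.
case: (ltrP 0 (k b)) => k0.
  by rewrite gtr0_norm//; apply/eqP; lra.
by rewrite ler0_norm// subrr mulr0 eqxx.
Qed.

End algebra.
End bounded_closure.

(** * A countable family of bumps *)

Section countable_bumps.
Context {R : realType} {d : nat}.
Implicit Types (p : 'rV[rat]_d * nat) (s : seq ('rV[rat]_d * nat)) (x y : 'rV[R]_d).

Definition tent p x : R := Num.max 0 (1 - p.2.+1%:R * `|x - map_mx ratr p.1|).

Lemma tent01 p x : 0 <= tent p x <= 1.
Proof.
rewrite /tent le_max lexx ge_max ler01 /= gerBl.
by apply: mulr_ge0.
Qed.

Lemma tent_gt0 p x : (0 < tent p x) = (x \in rational_ball p).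
Proof.
rewrite /tent lt_max ltxx /= subr_gt0 mulrC -ltr_pdivlMr// mul1r.
by apply/idP/idP; rewrite inE.
Qed.

Lemma bump_tent p : bump (tent p).
Proof.
split; first exact: tent01.
  exists p.2.+1%:R => x y; rewrite /tent.
  have maxL (a b : R) : `|Num.max 0 a - Num.max 0 b| <= `|a - b|.
    have /andP[l1 l2] : - `|a - b| <= a - b <= `|a - b| by rewrite -ler_norml.
    by rewrite ler_norml; case: (lerP 0 a) => ?; case: (lerP 0 b) => ?; apply/andP; split; lra.
  apply: le_trans (maxL _ _) _.
  have E (c u v : R) : 1 - c * u - (1 - c * v) = c * (v - u) by ring.
  rewrite E normrM ger0_norm//.
  apply: ler_wpM2l => //.
  apply: le_trans (ler_dist_dist _ _) _.
  by rewrite opprB addrA subrK distrC.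
exists (1 + `|map_mx ratr p.1 : 'rV[R]_d|) => x xr.
rewrite /tent max_l// subr_le0.
have := ler_normB (x - map_mx ratr p.1) (- map_mx ratr p.1).
rewrite opprK subrK normrN => h.
have h1 : 1 <= `|x - map_mx ratr p.1| by lra.
by rewrite -[leLHS]mulr1 ler_pM// ler1n.
Qed.

(** A continuous substitute for the indicator of a finite union of rational balls. Finite sequences
    of such balls are countable, hence so is this family. *)
Definition union_bump s : 'rV[R]_d -> R :=
  foldr (fun p phi x => 1 - (1 - tent p x) * (1 - phi x)) (fun=> 0) s.

Lemma bump_union_bump s : bump (union_bump s).
Proof.
elim: s => [|p s IH]; first exact: bump0.
by apply: bump_cup => //; exact: bump_tent.
Qed.

Lemma union_bumpE s x : union_bump s x = 1 - \prod_(p <- s) (1 - tent p x).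
Proof.
elim: s => [|p s IH]; first by rewrite big_nil subrr.
by rewrite big_cons /= IH subKr.
Qed.

Lemma union_bump_cvg (U : set 'rV[R]_d) : open U ->
  exists s_ : nat -> seq ('rV[rat]_d * nat),
    forall x, (fun n => union_bump (s_ n) x) @ \oo --> (\1_U x : R).
Proof.
move=> oU.
pose L n := [seq p <- pmap unpickle (iota 0 n) | `[< rational_ball p `<=` U >] ].
(* Listing each ball n times turns the product of the [1 - tent p x] into an
   n-th power, which tends to 0 at the points of U. *)
exists (fun n => flatten (nseq n (L n))) => x.
have prodE n : \prod_(p <- flatten (nseq n (L n))) (1 - tent p x) =
    (\prod_(p <- L n) (1 - tent p x)) ^+ n.
  by move: (L n) => l; elim: n => [|n IH]; rewrite /= ?big_nil// big_cat/= IH exprS.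
under eq_fun do rewrite union_bumpE prodE.
have tent1 p : 0 <= 1 - tent p x <= 1 by have := tent01 p x; lra.
have prod01 s : 0 <= \prod_(p <- s) (1 - tent p x) <= 1.
  by elim/big_rec: _ => [|p q _ q01]; [rewrite ler01 lexx|have := tent1 p; nra].
rewrite indicE; have [|xU] := boolP (x \in U); last first.
  apply: cvg_near_cst; apply: nearW => n.
  rewrite big1_seq ?expr1n ?subrr// => p /=; rewrite mem_filter => /andP[/asboolP pU _].
  have : ~~ (0 < tent p x).
    by rewrite tent_gt0; apply: contra xU; rewrite !inE; exact: pU.
  by have := tent01 p x; rewrite -leNgt => ? ?; lra.
rewrite inE => /(open_rational_ball oU)[p pU px].
have t0 : 0 < tent p x by rewrite tent_gt0 inE.
have -> : true%:R = 1 - 0 :> R by rewrite subr0.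
apply: cvgB; first exact: cvg_cst.
apply: (@squeeze_cvgr _ _ _ _ (cst 0) (fun n => (1 - tent p x) ^+ n)).
(* For [n] above the code of [p], the ball [p] is in [L n]; the other factors of the product are at
   most 1. *)
- exists (pickle p).+1 => // n /= pn; have /andP[q0 q1] := prod01 (L n).
  rewrite exprn_ge0//= lerXn2r// ?nnegrE//.
    by have /andP[] := tent1 p.
  have pL : p \in L n.
    rewrite mem_filter; apply/andP; split; first exact/asboolP.
    by rewrite mem_pmap; apply/mapP; exists (pickle p); rewrite ?pickleK// mem_iota.
  rewrite (big_rem _ pL)/= -[leRHS]mulr1 ler_wpM2l//.
    by have /andP[] := tent1 p.
  by have /andP[] := prod01 (rem p (L n)).
- exact: cvg_cst.
- by apply: cvg_expr; have /andP[? ?] := tent01 p x; rewrite ger0_norm; lra.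
Qed.

(** By dominated convergence, the countably many correlations at [b.2] determine the translate of
    [b.1] by [- b.2] on open sets. *)
Lemma cvg_corr_union_bump (U : set 'rV[R]_d) (s_ : nat -> seq ('rV[rat]_d * nat))
    (b : subprob R d * 'rV[R]_d) :
  open U -> (forall x, (fun n => union_bump (s_ n) x) @ \oo --> (\1_U x : R)) ->
  (fun n => corr (union_bump (s_ n)) b) @ \oo -->
  fine (b.1 (translation (- b.2) @^-1` (U : set (Rd R d)))).
Proof.
move=> oU sU.
have mU : measurable (U : set (Rd R d)) by exact: open_measurable_Rd.
rewrite -[X in b.1 X](setIT) -integral_indic//; last exact: measurable_preimage_translation.
apply: (@cvg_Rintegral_bounded _ _ _ b.1
  (fun n y => union_bump (s_ n) ((y : 'rV[R]_d) - b.2)) _ 1).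
- by move=> n; exact: (measurable_bump _ (bump_union_bump _)).
- by move=> n y; exact: (bump_norm _ (bump_union_bump _)).
- by move=> y; exact: sU.
Qed.

End countable_bumps.

(** * Moments of a collection *)

Section moments.
Context {R : realType} {d : nat}.
Notation E := (subprob R d * 'rV[R]_d)%type.
Implicit Types (xi : collection R d) (h : E -> R) (alpha beta : subprob R d).

(** The parameter bounds the number of factors from below: [monomials 1] comes from functions of at
    least two variables, while [monomials 0] also contains the constant 1. *)
Definition monomials m : set (E -> R) := [set h | exists n (phi_ : nat -> 'rV[R]_d -> R),
  [/\ (m <= n)%N, forall j, bump (phi_ j) &
      h = fun b => \prod_(j < n) corr (phi_ j) b]].

Lemma monomial_bounded m h : monomials m h -> exists B, forall b, `|h b| <= B.
Proof.
move=> [n [phi_ [_ bphi ->]]]; exists 1 => b.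
rewrite normr_prod.
suff /andP[_ //] : 0 <= \prod_(j < n) `|corr (phi_ j) b| <= 1.
elim/big_ind: _ => [|u v /andP[u0 u1] /andP[v0 v1]|j _].
- by rewrite ler01 lexx.
- by rewrite mulr_ge0//= mulr_ile1.
- by rewrite normr_ge0 corr_norm.
Qed.

Lemma monomial_mul m g h : monomials m g -> monomials m h ->
  monomials m (fun b => g b * h b).
Proof.
move=> [n1 [phi1 [mn1 b1 ->]]] [n2 [phi2 [mn2 b2 ->]]].
exists (n1 + n2)%N, (fun j => if (j < n1)%N then phi1 j else phi2 (j - n1)%N); split.
- exact: leq_trans mn1 (leq_addr _ _).
- by move=> j; case: ifP.
- apply/funext => b; rewrite big_split_ord /=; congr (_ * _); apply: eq_bigr => j _.
    by rewrite ltn_ord.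
  by rewrite ltnNge leq_addr addKn.
Qed.

Lemma monomial_measurable m h alpha : monomials m h ->
  measurable_fun [set: Rd R d] (fun x => h (alpha, x : 'rV[R]_d)).
Proof.
move=> [n [phi_ [_ bphi ->]]]; apply: measurable_prod => j _.
exact: measurable_corr.
Qed.

Lemma bc_measurable (G : set (E -> R)) alpha :
  (forall h, G h -> measurable_fun [set: Rd R d] (fun x => h (alpha, x : 'rV[R]_d))) ->
  forall h, bounded_closure G h ->
  measurable_fun [set: Rd R d] (fun x => h (alpha, x : 'rV[R]_d)).
Proof.
move=> Gm h; elim=> {}h.
- exact: Gm.
- by move=> g _ ? _ ?; exact: measurable_funD.
- by move=> g _ ?; exact: measurable_funM.
- move=> g B _ Hm _ Hl; apply: (measurable_fun_cvg Hm) => x _; exact: Hl.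
Qed.

Definition moment xi h : R :=
  csum xi (fun i => \int[member xi i]_x h (member xi i, x : 'rV[R]_d)).

Lemma moment_dominated xi h B :
  (forall alpha, measurable_fun [set: Rd R d] (fun x => h (alpha, x : 'rV[R]_d))) ->
  (forall b, `|h b| <= B) ->
  dominated xi B (fun i => \int[member xi i]_x h (member xi i, x : 'rV[R]_d)).
Proof.
move=> mh hB i _; apply: (ler_norm_Rintegral _ (mh _)) => x; exact: hB.
Qed.

(** A moment is linear, and it respects bounded pointwise limits by dominated convergence, used once
    in each integral and once in the sum over the collection. *)
Lemma eq_moment_bc (G : set (E -> R)) xi1 xi2 :
  (forall alpha h, G h -> measurable_fun [set: Rd R d] (fun x => h (alpha, x : 'rV[R]_d))) ->
  (forall h, G h -> exists B, forall b, `|h b| <= B) ->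
  (forall h, G h -> moment xi1 h = moment xi2 h) ->
  forall h, bounded_closure G h -> moment xi1 h = moment xi2 h.
Proof.
move=> Gm Gb Ge h bh.
have bm g : bounded_closure G g -> forall alpha, _ :=
  fun bg alpha => bc_measurable (Gm alpha) bg.
have bb g : bounded_closure G g -> _ := fun bg => bc_bounded Gb bg.
elim: bh => {}h.
- exact: Ge.
- move=> g bh eh bg eg.
  have [B HB] := bb _ bh; have [C HC] := bb _ bg.
  have mD xi : moment xi (fun b => h b + g b) = moment xi h + moment xi g.
    rewrite /moment -(csumD (moment_dominated (bm _ bh) HB) (moment_dominated (bm _ bg) HC)).
    apply: eq_csum => i _; rewrite RintegralD//.
      by apply: (@bounded_integrable _ _ _ _ _ B) => //; exact: bm.
    by apply: (@bounded_integrable _ _ _ _ _ C) => //; exact: bm.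
  by rewrite !mD eh eg.
- move=> g bg eg; have [B HB] := bb _ bg.
  have mZ xi : moment xi (fun b => h * g b) = h * moment xi g.
    rewrite /moment -(csumZ _ (moment_dominated (bm _ bg) HB)).
    apply: eq_csum => i _; rewrite RintegralZl//.
    by apply: (@bounded_integrable _ _ _ _ _ B) => //; exact: bm.
  by rewrite !mZ eg.
- move=> g B bh eh HB Hl.
  have mL xi : (fun n => moment xi (h n)) @ \oo --> moment xi g.
    apply: cvg_csum_dominated => [n|i _].
      exact: moment_dominated (bm _ (bh n)) (HB n).
    by apply: (@cvg_Rintegral_bounded _ _ _ _ _ _ B) => // n; exact: (bm _ (bh n)).
  have := mL xi1; under eq_fun do rewrite eh.
  by move=> /cvg_lim <-//; rewrite (cvg_lim _ (mL xi2)).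
Qed.

(** The mass is the limit of single correlations with bumps that converge to 1 on the whole
    space. *)
Lemma bc_mass m : (m <= 1)%N -> bounded_closure (monomials m) (fun b => mass b.1).
Proof.
move=> m1; have [s_ sT] := @union_bump_cvg R d setT openT.
apply: (bc_lim (h_ := fun n => corr (union_bump (s_ n))) (B := 1)).
- move=> n; apply: bc_base; exists 1%N, (fun=> union_bump (s_ n)); split=> //.
    by move=> _; exact: bump_union_bump.
  by apply/funext => b; rewrite big_ord1.
- by move=> n b; exact: (corr_norm _ (bump_union_bump _)).
- by move=> b; exact: (cvg_corr_union_bump openT sT).
Qed.

Lemma Rintegral_measure0 alpha (g : Rd R d -> R) B :
  measurable_fun setT g -> (forall x, `|g x| <= B) -> mass alpha = 0 ->
  \int[alpha]_x g x = 0.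
Proof.
move=> mg gB a0; apply/eqP; rewrite -normr_le0.
by apply: le_trans (ler_norm_Rintegral alpha mg gB) _; rewrite -/(mass _) a0 mulr0.
Qed.

(* The empty product does not come from a function in [calF].  Its moment is
   that of the indicator of nonzero mass, i.e. of the limit of
   [1 - (1 - mass) ^+ n], which is a combination of nonempty products. *)
Lemma eq_moment xi1 xi2 :
  (forall h, monomials 1 h -> moment xi1 h = moment xi2 h) ->
  forall h, bounded_closure (monomials 0) h -> moment xi1 h = moment xi2 h.
Proof.
move=> H; apply: eq_moment_bc.
- by move=> alpha h; exact: monomial_measurable.
- exact: monomial_bounded.
move=> h [[|n] [phi_ [_ bphi ->]]]; last first.
  by apply: H; exists n.+1, phi_.
have supp xi : moment xi (fun b => \prod_(j < 0) corr (phi_ j) b) =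
    moment xi (fun b => (mass b.1 != 0)%:R).
  apply: eq_csum => i _ /=.
  under eq_Rintegral do rewrite big_ord0.
  have [m0|//] := eqVneq (mass (member xi i)) 0.
  rewrite (@Rintegral_measure0 _ _ 1)//; last by move=> ?; rewrite normr1.
  by rewrite (@Rintegral_measure0 _ _ 0)// => ?; rewrite normr0.
have mass01 (b : E) : 0 <= mass b.1 <= 1 by rewrite mass_ge0 mass_le1.
have bs := bc_support (@monomial_bounded 1) (@monomial_mul 1) mass01 (bc_mass (leqnn 1)).
rewrite !supp; apply: eq_moment_bc H _ bs; last exact: monomial_bounded.
by move=> alpha h'; exact: monomial_measurable.
Qed.

Lemma monomial_one : monomials 0 (fun=> 1).
Proof.
exists 0%N, (fun=> fun=> 0); split=> // [j|]; first exact: bump0.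
by apply/funext => b; rewrite big_ord0.
Qed.

Lemma bc_set_corr_near phi c e : bump phi ->
  bc_set (monomials 0) [set b : E | `|corr phi b - c| < e].
Proof.
move=> bphi.
have bcorr : bounded_closure (monomials 0) (corr phi).
  apply: bc_base; exists 1%N, (fun=> phi); split => //.
  by apply/funext => b; rewrite big_ord1.
have cst k : bounded_closure (monomials 0) (fun=> k : R) by exact: bc_cst monomial_one k.
have -> : [set b | `|corr phi b - c| < e] =
    [set b | 0 < corr phi b - (c - e)] `&` [set b | 0 < (c + e) - corr phi b].
  apply/seteqP; split=> b /=; first by rewrite ltr_norml => /andP[? ?]; split; lra.
  by move=> [? ?]; rewrite ltr_norml; apply/andP; split; lra.
have gt0 h : bounded_closure (monomials 0) h -> bc_set (monomials 0) [set b | 0 < h b].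
  by apply: bc_set_gt0; [exact: monomial_bounded|exact: monomial_mul|exact: monomial_one].
apply: bc_setI; first exact: monomial_bounded.
- exact: monomial_mul.
- by apply: gt0; exact: bc_sub.
- by apply: gt0; exact: bc_sub.
Qed.

End moments.

(** * Recognising an orbit by countably many correlations *)

Section orbits_are_measurable.
Context {R : realType} {d : nat}.
Implicit Types (alpha beta : subprob R d) (x y v : 'rV[R]_d).

Lemma corr_translation phi alpha beta v x : bump phi ->
  (forall A, measurable A -> beta A = alpha (translation v @^-1` A)) ->
  corr phi (beta, x) = corr phi (alpha, x - v).
Proof.
move=> bphi H; apply: EFin_inj; rewrite !EFin_corr//.
rewrite -/(giry_int _ _) (giry_int_translation H).
- by apply: eq_integral => y _ /=; congr ((phi _)%:E); rewrite /translation opprB addrA addrAC.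
- by apply/measurable_EFinP; exact: measurable_bump.
- by move=> y; rewrite lee_fin; case: bphi => /(_ (y - x))/andP[].
Qed.

(** The translates of [beta] by [- x] and of [alpha] by [- y] agree on open sets, which are stable
    under intersection and generate the Borel sets, so they agree on all of these. *)
Lemma orbit_of_corr alpha beta x y :
  (forall s, corr (union_bump s) (beta, x) = corr (union_bump s) (alpha, y)) ->
  measure_orbit alpha beta.
Proof.
move=> H.
have HU (U : set (Rd R d)) : measurable U ->
    giry_map (measurable_translation (- x)) beta U =
    giry_map (measurable_translation (- y)) alpha U.
  move=> mU; apply: (@measure_unique _ R (Rd R d) (@open 'rV[R]_d) (fun=> setT) _ _ _ _
    (giry_map (measurable_translation (- x)) beta)
    (giry_map (measurable_translation (- y)) alpha)) => // {mU}.
  - by move=> A A'; exact: openI.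
  - by move=> _; exact: openT.
  - by rewrite bigcup_const//; exists 0%N.
  - move=> {}U oU; have [s_ sU] := union_bump_cvg oU.
    have cb := @cvg_corr_union_bump _ _ _ _ (beta, x) oU sU.
    have ca := @cvg_corr_union_bump _ _ _ _ (alpha, y) oU sU.
    have mU v : measurable (translation v @^-1` (U : set (Rd R d))).
      by apply: measurable_preimage_translation; exact: open_measurable_Rd.
    have fE (g : subprob R d) v : (fine (g (translation v @^-1` (U : set (Rd R d)))))%:E =
        g (translation v @^-1` (U : set (Rd R d))).
      by rewrite fineK// fin_num_measure.
    rewrite /giry_map /pushforward /= -[LHS]fE -[RHS]fE; congr (_%:E).
    move: cb; under eq_fun do rewrite H.
    by move=> /cvg_lim/= <-//; rewrite (cvg_lim _ ca).
  - by move=> _; rewrite ltey_eq fin_num_measure.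
apply/measure_orbitP; exists (x - y) => A mA.
have := HU _ (measurable_preimage_translation x mA).
rewrite /giry_map /pushforward /= => E.
transitivity (beta (translation (- x) @^-1` (translation x @^-1` A))).
  by congr (beta _); apply/funext => z; rewrite /preimage /= /translation subrK.
rewrite [LHS]E; congr (alpha _); apply/funext => z.
by rewrite /preimage /= /translation -addrA (addrC (- y)).
Qed.

(** A cluster point of the approximate solutions in the closed ball is an exact solution. As [m]
    governs both the number of functions and the precision, every [l] is eventually tested with
    arbitrary precision. *)
Lemma corr_cluster (phi_ : nat -> 'rV[R]_d -> R) (b : subprob R d * 'rV[R]_d) alpha (r : R) :
  (forall l, bump (phi_ l)) ->
  (forall m : nat, exists y, `|y| <= r /\ forall l, (l < m)%N ->
     `|corr (phi_ l) b - corr (phi_ l) (alpha, y)| < m.+1%:R^-1) ->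
  exists y, forall l, corr (phi_ l) b = corr (phi_ l) (alpha, y).
Proof.
move=> bphi /choice[y_ Hy].
have cK : compact [set y : 'rV[R]_d | `|y| <= r].
  apply: bounded_closed_compact.
    by exists r; split=> [|t rt y /= yr]; [exact: num_real|exact: le_trans yr (ltW rt)].
  apply: (@closed_comp _ _ (fun u : 'rV[R]_d => `|u|) [set t | t <= r]).
    by move=> u _; exact: norm_continuous.
  exact: closed_le.
have [|y [_ cy]] := cK (y_ @ \oo) _.
  by exists 0%N => // m _; case: (Hy m).
exists y => l; apply/eqP; rewrite -subr_eq0 -normr_eq0.
apply: contraT => neq0.
have [L [L0 HL]] := corr_lipschitz alpha (bphi l).
set D := `|_| in neq0.
have D0 : 0 < D / 2 by rewrite divr_gt0// lt0r neq0 normr_ge0.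
have L1 : 0 < L + 1 by rewrite ltr_wpDl.
(* Half of [D] is spent on the precision at [y_ m], the other half on the Lipschitz move from [y_ m]
   to [y]. *)
pose far := [set y_ m | m in [set m : nat | (l < m)%N /\ m.+1%:R^-1 < D / 2]].
have Ffar : (y_ @ \oo) far.
  have [N _ HN] := near_infty_natSinv_lt (PosNum D0).
  exists (maxn N l.+1) => // m /=; rewrite geq_max => /andP[Nm lm].
  by exists m => //; split => //; exact: HN.
have Nball : nbhs y (ball y (D / 2 / (L + 1))).
  by apply: nbhsx_ballx; exact: divr_gt0.
have [_ [[m [lm mD] <-]]] := cy _ _ Ffar Nball.
rewrite -ball_normE /= => ym.
have [_ /(_ l lm) Hm] := Hy m.
have : D < D.
  rewrite [X in _ < X]splitr {1}/D.
  apply: le_lt_trans (ler_distD (corr (phi_ l) (alpha, y_ m)) _ _) _.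
  apply: ltrD; first exact: lt_trans Hm mD.
  apply: le_lt_trans (HL _ _) _.
  apply: (@le_lt_trans _ _ ((L + 1) * `|y - y_ m|)).
    by rewrite distrC ler_wpM2r// lerDl.
  by rewrite mulrC -ltr_pdivlMr.
by rewrite ltxx.
Qed.

Lemma bc_set_orbit alpha :
  bc_set (monomials 0) [set b : subprob R d * 'rV[R]_d | measure_orbit alpha b.1].
Proof.
have Gb := @monomial_bounded R d 0; have Gm := @monomial_mul R d 0.
have G1 := @monomial_one R d.
pose phi_ l : 'rV[R]_d -> R := union_bump (odflt [::] (unpickle l)).
pose y_ j : 'rV[R]_d := map_mx ratr (odflt 0 (unpickle j) : 'rV[rat]_d).
have bphi l : bump (phi_ l) by exact: bump_union_bump.
have bT : bc_set (monomials 0) [set: subprob R d * 'rV[R]_d].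
  by rewrite -setC0; apply: bc_setC => //; have [] := sigma_algebra_bc Gb Gm G1.
have bcap (A_ : nat -> set (subprob R d * 'rV[R]_d)) :
    (forall n, bc_set (monomials 0) (A_ n)) -> bc_set (monomials 0) (\bigcap_n A_ n).
  move=> bA; rewrite -[X in bc_set _ X]setCK setC_bigcap.
  by apply: bc_setC => //; apply: bc_bigcup => // n; exact: bc_setC.
(* In words: for some radius [N] and every [m], a rational point of norm at most [N] matches the
   first [m] correlations up to [1 / (m + 1)]. The radius is fixed before [m], so that the matching
   points stay in a compact set. *)
rewrite (_ : mkset _ = \bigcup_(N : nat) \bigcap_(m : nat) \bigcup_(j : nat)
  ([set _ | `|y_ j| <= N%:R] `&` \bigcap_(l : nat)
    [set b | (l < m)%N -> `|corr (phi_ l) b - corr (phi_ l) (alpha, y_ j)| < m.+1%:R^-1])).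
  apply: bc_bigcup => // N; apply: (bcap) => m; apply: bc_bigcup => // j.
  apply: bc_setI => //.
    (* This condition does not involve [b]: the set is everything or empty. *)
    have [yN|yN] := boolP (`|y_ j| <= N%:R).
      by rewrite (_ : mkset _ = setT)//; apply/seteqP; split.
    by rewrite -[X in bc_set _ X]setCK; apply: bc_setC => //; rewrite (_ : ~` _ = setT)//;
      apply/seteqP; split => // b _; exact/negP.
  apply: bcap => l; have [lm|lm] := boolP (l < m)%N.
    rewrite (_ : mkset _ =
        [set b | `|corr (phi_ l) b - corr (phi_ l) (alpha, y_ j)| < m.+1%:R^-1]).
      exact: bc_set_corr_near.
    by apply/seteqP; split => b /=; [exact|].
  by rewrite (_ : mkset _ = setT)//; apply/seteqP; split.
apply/seteqP; split=> -[beta x] /=.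
  move=> /measure_orbitP[v H].
  (* The extra 1 leaves room for a rational point within distance 1 of [x - v]. *)
  have [N HN] : exists N : nat, `|x - v| + 1 <= N%:R.
    by exists (Num.truncn (`|x - v| + 1)).+1; exact/ltW/truncnS_gt.
  exists N => // m _.
  have [e [e0 He]] : exists e : R, 0 < e /\ forall y l, (l < m)%N -> `|x - v - y| < e ->
      `|corr (phi_ l) (alpha, x - v) - corr (phi_ l) (alpha, y)| < m.+1%:R^-1.
    have : 0 < m.+1%:R^-1 :> R by rewrite invr_gt0.
    (* The tolerance is made independent of [m], so that the induction runs only on the number of
       functions sharing the radius [e]. *)
    move: (m.+1%:R^-1) => t t0; elim: m => [|m [e [e0 He]]]; first by exists 1.
    have [L [L0 HL]] := corr_lipschitz alpha (bphi m).
    have L1 : 0 < L + 1 by rewrite ltr_wpDl.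
    exists (Num.min e (t / (L + 1))); split; first by rewrite lt_min e0 divr_gt0.
    move=> y l; rewrite ltnS leq_eqVlt lt_min => /predU1P[->|lm] /andP[ye yt]; last exact: He.
    apply: le_lt_trans (HL _ _) _.
    apply: (@le_lt_trans _ _ ((L + 1) * `|x - v - y|)); first by rewrite ler_wpM2r// lerDl.
    by rewrite mulrC -ltr_pdivlMr.
  have [q Hq] := @rational_approx R 1 d (x - v) (Num.min e 1)
    (ltac:(by rewrite lt_min e0 ltr01)).
  move: Hq; rewrite lt_min => /andP[qe q1].
  have yq : y_ (pickle q) = map_mx ratr q by rewrite /y_ pickleK.
  exists (pickle q) => //; split=> [|l _ lm]; rewrite /= yq.
    have := ler_distD (x - v) (map_mx ratr q) 0; rewrite !subr0 distrC; lra.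
  by rewrite (corr_translation _ (bphi l) H); exact: He.
move=> [N _ HN].
have [|y Hy] := @corr_cluster phi_ (beta, x) alpha N%:R bphi.
  move=> m; have [j _ [yN Hj]] := HN m I.
  by exists (y_ j); split => // l lm; exact: Hj.
apply: (@orbit_of_corr _ _ x y) => s.
by have := Hy (pickle s); rewrite /phi_ pickleK.
Qed.

End orbits_are_measurable.

(** * The distance *)

Section distance.
Context {R : realType} {d : nat}.
Implicit Types (xi : collection R d) (alpha : subprob R d).

Lemma sup_norm_ge k (g : 'M[R]_(k, d) -> R) : (2 <= k)%N -> calF g ->
  forall X, `|g X| <= sup_norm g.
Proof.
case: k g => [//|k] g _ /calF_bounded[B HB] X.
by apply: ub_le_sup; [exists B => _ [Y _ <-]; exact: HB|exists X].
Qed.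

Lemma sup_norm_ge0 k (g : 'M[R]_(k, d) -> R) : (2 <= k)%N -> calF g -> 0 <= sup_norm g.
Proof. by move=> k2 Fg; apply: le_trans (sup_norm_ge k2 Fg 0). Qed.

Lemma integral_power_dominated k (g : 'M[R]_(k, d) -> R) B alpha :
  (2 <= k)%N -> continuous g -> (forall X, `|g X| <= B) ->
  `|integral_power (existT _ k g) alpha| <= B * mass alpha.
Proof. by case: k g => [//|k] g _; exact: ler_norm_integral_power. Qed.

Lemma sum_integralsE (f : @test_function R d) xi :
  sum_integrals f xi = csum xi (integral_power f \o member xi).
Proof. by []. Qed.

Lemma sum_integrals_same_orbits k (g : 'M[R]_(k, d) -> R) xi1 xi2 :
  (2 <= k)%N -> calF g -> same_orbits xi1 xi2 ->
  sum_integrals (existT _ k g) xi1 = sum_integrals (existT _ k g) xi2.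
Proof.
move=> k2 Fg; have [cg invg _] := Fg; rewrite !sum_integralsE.
apply: csum_same_orbits => [alpha|alpha beta].
  exact: integral_power_dominated k2 cg (sup_norm_ge k2 Fg).
exact: integral_power_orbit.
Qed.

Lemma sum_integrals_norm k (g : 'M[R]_(k, d) -> R) xi :
  (2 <= k)%N -> calF g -> `|sum_integrals (existT _ k g) xi| <= sup_norm g.
Proof.
move=> k2 Fg; have [cg _ _] := Fg; rewrite sum_integralsE.
apply: csum_norm; first exact: sup_norm_ge0.
by move=> i _; exact: integral_power_dominated k2 cg (sup_norm_ge k2 Fg).
Qed.

(** The estimate is uniform in the collection because its total mass is at most 1; it transfers
    equalities from the dense sequence to all of [calF]. *)
Lemma sum_integrals_dist k (g h : 'M[R]_(k, d) -> R) e xi :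
  (2 <= k)%N -> calF g -> calF h -> 0 <= e -> (forall X, `|g X - h X| <= e) ->
  `|sum_integrals (existT _ k g) xi - sum_integrals (existT _ k h) xi| <= e.
Proof.
case: k g h => [//|k] g h k2 Fg Fh e0 ghe.
have [cg _ _] := Fg; have [ch _ _] := Fh.
have gB := sup_norm_ge k2 Fg; have hB := sup_norm_ge k2 Fh.
rewrite !sum_integralsE -(@csumB _ _ _ (sup_norm g) (sup_norm h)).
- apply: csum_norm => // i _ /=; rewrite (integral_powerB _ cg ch gB hB).
  apply: ler_norm_integral_power; last exact: ghe.
  by move=> X; apply: continuousB; [exact: cg|exact: ch].
- by move=> i _; exact: integral_power_dominated k2 cg gB.
- by move=> i _; exact: integral_power_dominated k2 ch hB.
Qed.

(** Equality of moments is carried from [star] functions to the indicator of an orbit. That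
    indicator is constant in [x], so its moment counts the occurrences weighted by their mass. *)
Lemma same_orbits_of_sum_integrals xi1 xi2 :
  (forall k (g : 'M[R]_(k, d) -> R), (2 <= k)%N -> calF g ->
    sum_integrals (existT _ k g) xi1 = sum_integrals (existT _ k g) xi2) ->
  same_orbits xi1 xi2.
Proof.
move=> H.
have mono h : monomials 1 h -> moment xi1 h = moment xi2 h.
  move=> [n [phi_ [n0 bphi ->]]].
  have momentE xi : moment xi (fun b => \prod_(j < n) corr (phi_ j) b) =
      sum_integrals (existT _ n.+1 (@star R d n phi_)) xi.
    by rewrite sum_integralsE; apply: eq_csum => i _ /=; rewrite integral_power_star.
  (* At least one factor means at least two variables, as required of [k]. *)
  by rewrite !momentE; apply: H => //; exact: calF_star.
apply/asboolP => alpha a0; apply: card_occurrences.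
  by rewrite /mass; apply: contra_neq a0 => a0; rewrite -massE /mass a0.
have := eq_moment mono (bc_set_orbit alpha).
have momentE xi : moment xi \1_[set b | measure_orbit alpha b.1] =
    csum xi (fun i => \1_(measure_orbit alpha) (member xi i) * mass (member xi i)).
  apply: eq_csum => i _.
  transitivity (\int[member xi i]_(x in setT) (\1_(measure_orbit alpha) (member xi i) : R)).
    2: by rewrite Rintegral_cst.
  by apply: eq_Rintegral => x _; rewrite !indicE; congr ((nat_of_bool _)%:R).
by rewrite !momentE.
Qed.

(** * Metric properties on collections *)

Section dense_sequence.
Variable f : nat -> @test_function R d.
Hypothesis hf : dense_in_calF f.

Definition D_term xi1 xi2 r : R := (2 ^+ r.+1)^-1 * (1 + sup_norm (projT2 (f r)))^-1 *
  `|sum_integrals (f r) xi1 - sum_integrals (f r) xi2|.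

Lemma weight_gt0 r : 0 < (2 ^+ r.+1)^-1 * (1 + sup_norm (projT2 (f r)))^-1 :> R.
Proof.
have [k2 Fr] := hf.1 r; have s0 := sup_norm_ge0 k2 Fr.
by rewrite mulr_gt0// invr_gt0 ?exprn_gt0// ltr_pwDl.
Qed.

Lemma D_term_ge0 xi1 xi2 r : 0 <= D_term xi1 xi2 r.
Proof. by rewrite /D_term mulr_ge0// ltW// weight_gt0. Qed.

(** Each sum of integrals is at most the sup norm, so the difference is at most
    [2 * (1 + sup_norm g)]; the factor 2 lowers the exponent [r.+1] to [r]. *)
Lemma D_term_le xi1 xi2 r : D_term xi1 xi2 r <= geometric 1 2^-1 r.
Proof.
rewrite /D_term /=; have [k2 Fr] := hf.1 r; have s0 := sup_norm_ge0 k2 Fr.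
move: k2 Fr s0; case: (f r) => k g /= k2 Fg s0.
have := sum_integrals_norm xi1 k2 Fg; have := sum_integrals_norm xi2 k2 Fg.
move: (sum_integrals _ xi1) (sum_integrals _ xi2) => u v vs us.
have uv : `|u - v| <= 2 * (1 + sup_norm g).
  by apply: le_trans (ler_normB _ _) _; lra.
have p : 0 < 1 + sup_norm g by rewrite ltr_pwDl.
rewrite mul1r exprVn.
apply: (@le_trans _ _ ((2 ^+ r.+1)^-1 * (1 + sup_norm g)^-1 * (2 * (1 + sup_norm g)))).
  by apply: ler_wpM2l => //; rewrite mulr_ge0 ?invr_ge0 ?exprn_ge0// ltW.
rewrite exprS invfM le_eqVlt; apply/orP; left; apply/eqP; field.
by rewrite expf_neq0 ?pnatr_eq0//= gt_eqF.
Qed.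

Lemma cvg_D_term xi1 xi2 : cvgn (series (D_term xi1 xi2)).
Proof.
apply: (series_le_cvg (v_ := geometric 1 2^-1)).
- exact: D_term_ge0.
- by move=> n; rewrite /= mul1r exprn_ge0.
- exact: D_term_le.
- by apply: is_cvg_geometric_series; rewrite ger0_norm; lra.
Qed.

Lemma D_collectionE xi1 xi2 : D_collection f xi1 xi2 = limn (series (D_term xi1 xi2)).
Proof. by []. Qed.

Lemma D_collection_same_orbits xi1 xi2 xi1' xi2' :
  same_orbits xi1 xi1' -> same_orbits xi2 xi2' ->
  D_collection f xi1 xi2 = D_collection f xi1' xi2'.
Proof.
move=> s1 s2; rewrite !D_collectionE; congr (limn (series _)); apply/funext => r.
rewrite /D_term; have [k2 Fr] := hf.1 r; move: k2 Fr; case: (f r) => k g /= k2 Fg.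
by rewrite (sum_integrals_same_orbits k2 Fg s1) (sum_integrals_same_orbits k2 Fg s2).
Qed.

Lemma D_collection_ge0 xi1 xi2 : 0 <= D_collection f xi1 xi2.
Proof.
rewrite D_collectionE; apply: limr_ge; first exact: cvg_D_term.
by apply: nearW => n; rewrite /series /= sumr_ge0// => r _; exact: D_term_ge0.
Qed.

Lemma D_collection_sym xi1 xi2 : D_collection f xi1 xi2 = D_collection f xi2 xi1.
Proof.
rewrite !D_collectionE; congr (limn (series _)); apply/funext => r.
by rewrite /D_term distrC.
Qed.

Lemma D_collection_triangle xi1 xi2 xi3 :
  D_collection f xi1 xi3 <= D_collection f xi1 xi2 + D_collection f xi2 xi3.
Proof.
rewrite !D_collectionE -lim_seriesD; [|exact: cvg_D_term..].
apply: lim_series_le; [exact: cvg_D_term|apply: is_cvg_seriesD; exact: cvg_D_term|] => r.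
change (D_term xi1 xi3 r <= D_term xi1 xi2 r + D_term xi2 xi3 r); rewrite /D_term -mulrDr.
by apply: ler_wpM2l; [rewrite ltW// weight_gt0|exact: ler_distD].
Qed.

(** Nonnegative terms with sum 0 all vanish, so the sums of integrals agree for every [f r]. A
    general test function is approximated within [e / 2], once for each collection. *)
Lemma D_collection_eq0 xi1 xi2 : D_collection f xi1 xi2 = 0 -> same_orbits xi1 xi2.
Proof.
move=> D0.
have sr r : sum_integrals (f r) xi1 = sum_integrals (f r) xi2.
  have nd : nondecreasing_seq (series (D_term xi1 xi2)).
    by apply: nondecreasing_series => n _ _; exact: D_term_ge0.
  have := nondecreasing_cvgn_le nd (@cvg_D_term xi1 xi2) r.+1.
  rewrite -D_collectionE D0 seriesEnat /= big_nat_recr//= => tr.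
  have t0 : D_term xi1 xi2 r <= 0.
    by apply: le_trans tr; rewrite lerDr sumr_ge0// => i _; exact: D_term_ge0.
  have : D_term xi1 xi2 r == 0 by rewrite eq_le t0 D_term_ge0.
  rewrite /D_term mulf_eq0 gt_eqF ?weight_gt0//= normr_eq0 subr_eq0.
  by move/eqP.
apply: same_orbits_of_sum_integrals => k g k2 Fg.
apply/eqP; rewrite -subr_eq0 -normr_le0; apply/ler_addgt0Pl => e e0.
rewrite addr0.
have e2 : 0 < e / 2 by lra.
have [r [h [fr hg]]] := hf.2 k g _ k2 Fg e2.
have Fh : calF h by have [_] := hf.1 r; rewrite fr.
have d1 := sum_integrals_dist xi1 k2 Fh Fg (ltW e2) (fun X => ltW (hg X)).
have d2 := sum_integrals_dist xi2 k2 Fh Fg (ltW e2) (fun X => ltW (hg X)).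
have := sr r; rewrite fr => E; rewrite E distrC in d1.
by rewrite [e]splitr; apply: le_trans (ler_distD _ _ _) (lerD d1 d2).
Qed.

End dense_sequence.
End distance.

(* The first conclusion says that D is well defined on Xtilde: its value does
   not depend on the representing collections. *)
Theorem theorem3p1 (R : realType) (d : nat) (f : nat -> @test_function R d)
    (hf : dense_in_calF f) :
  (forall xi1 xi2 : collection R d,
     D f (\pi_(Xtilde R d) xi1)%qT (\pi_(Xtilde R d) xi2)%qT
     = D_collection f xi1 xi2) /\
  is_metric (D f).
Proof.
have piP xi1 xi2 : \pi_(Xtilde R d)%qT xi1 = \pi_(Xtilde R d)%qT xi2 <->
    same_orbits xi1 xi2.
  by split=> [/(eqmodP (same_orbits_equiv R d))|s];
    [|exact/(eqmodP (same_orbits_equiv R d))].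
(* The representative of a class is known only up to [same_orbits], which [D_collection f]
   respects. *)
have repr_pi xi : same_orbits (repr (\pi_(Xtilde R d) xi)%qT) xi.
  by apply/piP; rewrite reprK.
split=> [xi1 xi2|]; first exact: D_collection_same_orbits.
split=> [x y|x y|x y|x y z]; rewrite /D.
- exact: D_collection_ge0.
- split=> [/(D_collection_eq0 hf) s|->].
    rewrite -[x]reprK -[y]reprK.
    exact/piP.
  rewrite D_collectionE (_ : D_term _ _ _ = cst 0); last first.
    by apply/funext => r; rewrite /D_term subrr normr0 mulr0.
  apply/cvg_lim => //; apply: cvg_near_cst; apply: nearW => n.
  by rewrite /series /= big1.
- exact: D_collection_sym.
- exact: D_collection_triangle.
Qed.
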